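(* For any pair of smooth degree-$6$ curves $C_1$ and $C_2$ in $\mathbb{P}^2_{\mathbb{C}}$, the set $\mathcal{F}_{C_1,C_2}$ breaks up into finitely many $\mathrm{GL}_3(\mathbb{C})$-orbits.
   Context: Let $F_{\mathbb{C}}$ be the complete flag variety of $\mathbb{C}^3$, realized as the hypersurface $x_1z_1+x_2z_2+x_3z_3=0$ in $\mathbb{P}^2_{\mathbb{C}}\times\mathbb{P}^2_{\mathbb{C}}$, with projections $p_1,p_2:F_{\mathbb{C}}\to\mathbb{P}^2_{\mathbb{C}}$ to the $x$- and $z$-coordinates. The group $\mathrm{GL}_3(\mathbb{C})$ acts on $F_{\mathbb{C}}$ by $\gamma\cdot([x_1:x_2:x_3],[z_1:z_2:z_3])=([x_1:x_2:x_3]\gamma,[z_1:z_2:z_3]\delta(\gamma))$, where $\delta(\gamma)=\det(\gamma)(\gamma^{-1})^t$ is the cofactor matrix, and hence acts on the set of subvarieties of $F_{\mathbb{C}}$. A generic K3 surface in $F_{\mathbb{C}}$ is a subvariety $X\subset F_{\mathbb{C}}$ cut out by a section of $p_1^*\mathcal{O}(2)\otimes p_2^*\mathcal{O}(2)$ (i.e. by a bihomogeneous polynomial of degree $(2,2)$ in the $x_i$ and $z_i$) that is a (smooth) K3 surface and for which both restrictions $p_1,p_2:X\to\mathbb{P}^2_{\mathbb{C}}$ are covering maps (finite double covers of degree $2$). It is assumed throughout that the generic K3 surfaces considered have Picard rank $2$ over $\mathbb{C}$. For smooth degree-$6$ curves $C_1,C_2\subset\mathbb{P}^2_{\mathbb{C}}$,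 $\mathcal{F}_{C_1,C_2}$ denotes the set of generic K3 surfaces $X$ in $F_{\mathbb{C}}$ (of Picard rank $2$) such that the branch curves $B_1,B_2\subset\mathbb{P}^2_{\mathbb{C}}$ of $p_1|_X$ and $p_2|_X$ are $\mathrm{GL}_3(\mathbb{C})$-equivalent to $C_1$ and $C_2$ respectively (i.e. carried to them by projective linear transformations of $\mathbb{P}^2_{\mathbb{C}}$). The set $\mathcal{F}_{C_1,C_2}$ is closed under the action of $\mathrm{GL}_3(\mathbb{C})$. *)

(* Defs.v *)
From HB Require Import structures.
From mathcomp Require Import all_boot all_order all_algebra.
From mathcomp Require Import classical_sets functions cardinality reals.
From mathcomp Require Import mpoly complex.

Set Implicit Arguments.
Unset Strict Implicit.
Unset Printing Implicit Defensive.

Import GRing.Theory.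

Local Open Scope classical_set_scope.
Local Open Scope card_scope.
Local Open Scope ring_scope.

(* Conventions.  A subset of P^2 is encoded by the set of all nonzero vectors
   of K^3 representing its points, and a subset of P^2 x P^2 by the set of all
   representatives v = (x, z) with x and z nonzero.  Points are row vectors;
   x = lsubmx v and z = rsubmx v are the two homogeneous coordinate vectors.
   K is algebraically closed, so that varieties are determined by their
   K-points. *)

Section Geometry.
Variable K : closedFieldType.

Local Notation vec := ('rV[K]_(3 + 3)).
Local Notation poly6 := {mpoly K[3 + 3]}.

Definition ev (n : nat) (p : {mpoly K[n]}) (v : 'rV[K]_n) : K :=
  p.@[fun i => v 0 i].

Definition bihomog (a b : nat) (p : poly6) : Prop :=
  forall m, m \in msupp p ->
    (\sum_(i < 3) m (lshift 3 i))%N = a /\ (\sum_(i < 3) m (rshift 3 i))%N = b.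

Definition incidence : poly6 :=
  \sum_(i < 3) 'X_(lshift 3 i) * 'X_(rshift 3 i).

Definition flag_variety : set vec :=
  [set v | [/\ lsubmx v != 0, rsubmx v != 0 & ev incidence v = 0]].

Definition cut (q : poly6) : set vec :=
  [set v | flag_variety v /\ ev q v = 0].

Definition jacobian (q : poly6) (v : vec) : 'M[K]_(2, 3 + 3) :=
  \matrix_(i < 2, j < 3 + 3)
    ev (mderiv j (if i == 0 then incidence else q)) v.

(* Jacobian criterion for the scheme defined by [incidence] and [q]; it also
   forces this scheme to be reduced, of pure dimension 2. *)
Definition smooth_cut (q : poly6) : Prop :=
  forall v, cut q v -> \rank (jacobian q v) = 2%N.

Definition zopen (X U : set vec) : Prop :=
  U `<=` X /\
  forall v, U v -> exists (a b : nat) (s : poly6),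
    [/\ bihomog a b s, ev s v != 0 & forall w, X w -> ev s w != 0 -> U w].

Definition irreducible (X : set vec) : Prop :=
  X !=set0 /\
  forall U V, zopen X U -> zopen X V ->
    U !=set0 -> V !=set0 -> (U `&` V) !=set0.

(* [U] is meant to be Zariski open in the variety under consideration. *)
Definition regular (U : set vec) (f : vec -> K) : Prop :=
  forall v, U v -> exists (a b : nat) (g h : poly6),
    [/\ bihomog a b g, bihomog a b h, ev h v != 0 &
        forall w, U w -> ev h w != 0 -> f w = ev g w / ev h w].

(* H^1(X, O_X) = 0.  For a fixed cover, Cech H^1 injects into H^1, and H^1 is
   the union of these images; X is quasi-compact, so finite covers suffice. *)
Definition H1_structure_sheaf_zero (X : set vec) : Prop :=
  forall (n : nat) (U : 'I_n -> set vec) (c : 'I_n -> 'I_n -> vec -> K),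
    (forall i, zopen X (U i)) ->
    (forall v, X v -> exists i, U i v) ->
    (forall i j, regular (U i `&` U j) (c i j)) ->
    (forall i j k v, U i v -> U j v -> U k v -> c i j v + c j k v = c i k v) ->
    exists h : 'I_n -> vec -> K,
      (forall i, regular (U i) (h i)) /\
      (forall i j v, U i v -> U j v -> c i j v = h i v - h j v).

(* Tangent space at v of the 4-dimensional bi-cone over the surface.  The
   tangent space of the surface itself is its quotient by the two Euler
   vectors (x, 0) and (0, z). *)
Definition cone_tangent (q : poly6) (v t : vec) : Prop :=
  jacobian q v *m t^T = 0.

Definition euler_l (v : vec) : vec := row_mx (lsubmx v) 0.
Definition euler_r (v : vec) : vec := row_mx 0 (rsubmx v).

(* A regular 2-form on the surface, given by its pullback to the bi-cone: an
   alternating form on each tangent space which is locally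
   sum_ij (A_ij / s) dv_i (x) dv_j, with A_ij / s of bidegree opposite to that
   of v_i v_j (so that it is invariant under rescaling x and z), and which is
   annihilated by the Euler vectors. *)
Definition regular_2form (q : poly6) (omega : vec -> vec -> vec -> K) : Prop :=
  [/\ forall v, cut q v ->
        exists (a b : nat) (s : poly6) (A : 'I_(3 + 3) -> 'I_(3 + 3) -> poly6),
        [/\ bihomog a b s, ev s v != 0,
            forall i j, bihomog a b (A i j * 'X_i * 'X_j) &
            forall w t u, cut q w -> ev s w != 0 ->
              cone_tangent q w t -> cone_tangent q w u ->
              omega w t u =
                \sum_i \sum_j ev (A i j) w / ev s w * t 0 i * u 0 j],
      forall v t, cut q v -> cone_tangent q v t -> omega v t t = 0 &
      forall v t, cut q v -> cone_tangent q v t ->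
        omega v (euler_l v) t = 0 /\ omega v (euler_r v) t = 0].

Definition trivial_canonical_bundle (q : poly6) : Prop :=
  exists2 omega, regular_2form q omega &
    forall v, cut q v -> exists t u,
      [/\ cone_tangent q v t, cone_tangent q v u & omega v t u != 0].

Definition K3_cut (q : poly6) : Prop :=
  [/\ smooth_cut q, irreducible (cut q), trivial_canonical_bundle q
    & H1_structure_sheaf_zero (cut q)].

(* The pair (g, h) stands for the nonzero rational function g / h on X; the
   componentwise product of pairs is the product of rational functions. *)
Definition ratfun (X : set vec) (f : poly6 * poly6) : Prop :=
  exists a b : nat,
    [/\ bihomog a b f.1, bihomog a b f.2,
        exists2 v, X v & ev f.1 v != 0 & exists2 v, X v & ev f.2 v != 0].

Definition rinv (f : poly6 * poly6) : poly6 * poly6 := (f.2, f.1).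

Definition rpow (f : poly6 * poly6) (n : int) : poly6 * poly6 :=
  match n with Posz k => f ^+ k | Negz k => rinv f ^+ k.+1 end.

Definition unit_at (X : set vec) (v : vec) (f : poly6 * poly6) : Prop :=
  exists (a b : nat) (s t : poly6),
    [/\ bihomog a b s, bihomog a b t, ev s v != 0, ev t v != 0 &
        forall w, X w -> ev f.1 w * ev t w = ev f.2 w * ev s w].

(* A global section of the sheaf K(X)^* / O_X^*: [D v] represents its germ at
   v, as an element of K(X)^* modulo the units of the local ring at v. *)
Definition cartier (X : set vec) (D : vec -> poly6 * poly6) : Prop :=
  (forall v, X v -> ratfun X (D v)) /\
  forall v, X v -> exists U, [/\ zopen X U, U v &
    forall w, U w -> unit_at X w (D v * rinv (D w))].

Definition principal (X : set vec) (D : vec -> poly6 * poly6) : Prop :=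
  exists2 f, ratfun X f & forall v, X v -> unit_at X v (f * rinv (D v)).

(* Linear independence over the integers of the classes of r Cartier divisors
   in the Picard group, i.e. modulo principal divisors. *)
Definition pic_independent (X : set vec) (r : nat)
    (D : 'I_r -> vec -> poly6 * poly6) : Prop :=
  forall n : 'I_r -> int,
    principal X (fun v => \prod_(i < r) rpow (D i v) (n i)) ->
    forall i, n i = 0.

Definition has_picard_rank (X : set vec) (r : nat) : Prop :=
  (exists D : 'I_r -> vec -> poly6 * poly6,
     (forall i, cartier X (D i)) /\ pic_independent X D) /\
  ~ (exists D : 'I_r.+1 -> vec -> poly6 * poly6,
       (forall i, cartier X (D i)) /\ pic_independent X D).

(* The fibres of the two projections, as sets of points of P^2 (a point being
   the line it spans in K^3). *)
Definition fibre1 (X : set vec) (x : 'rV[K]_3) : set {vspace 'rV[K]_3} :=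
  [set <[z]>%VS | z in [set z | X (row_mx x z)]].

Definition fibre2 (X : set vec) (z : 'rV[K]_3) : set {vspace 'rV[K]_3} :=
  [set <[x]>%VS | x in [set x | X (row_mx x z)]].

(* The projection with these fibres, from a projective variety to P^2, is
   finite (it is closed by properness) and has degree 2. *)
Definition double_cover (fibre : 'rV[K]_3 -> set {vspace 'rV[K]_3}) : Prop :=
  (forall x, x != 0 -> finite_set (fibre x)) /\
  exists (k : nat) (d : {mpoly K[3]}), [/\ d \is k.-homog, d != 0 &
    forall x, x != 0 -> ev d x != 0 -> fibre x #= `I_2].

(* Branch locus of a double cover: the points with fewer than two preimages. *)
Definition branch (fibre : 'rV[K]_3 -> set {vspace 'rV[K]_3}) : set 'rV[K]_3 :=
  [set x | x != 0 /\ ~ (fibre x #= `I_2)].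

Definition generic_K3 (X : set vec) : Prop :=
  exists q : poly6,
    [/\ bihomog 2 2 q, X = cut q, K3_cut q,
        double_cover (fibre1 X) & double_cover (fibre2 X)].

Definition smooth_sextic (C : set 'rV[K]_3) : Prop :=
  exists f : {mpoly K[3]},
    [/\ f \is 6.-homog, f != 0, C = [set x | x != 0 /\ ev f x = 0] &
        forall x, C x -> exists i : 'I_3, ev (mderiv i f) x != 0].

Definition proj_equiv (B C : set 'rV[K]_3) : Prop :=
  exists2 g : 'M[K]_3, g \in unitmx & [set x *m g | x in B] = C.

Definition delta (g : 'M[K]_3) : 'M[K]_3 := \det g *: (invmx g)^T.

Definition act (g : 'M[K]_3) (v : vec) : vec :=
  row_mx (lsubmx v *m g) (rsubmx v *m delta g).

Definition GL3_orbit (X : set vec) : set (set vec) :=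
  [set Y | exists2 g : 'M[K]_3, g \in unitmx & Y = act g @` X].

Definition K3_family (C1 C2 : set 'rV[K]_3) : set (set vec) :=
  [set X | [/\ generic_K3 X, has_picard_rank X 2,
               proj_equiv (branch (fibre1 X)) C1 &
               proj_equiv (branch (fibre2 X)) C2]].

End Geometry.

(* Main.v *)
(* The fibre over x of the first projection is the zero locus of a binary
   quadratic form on the plane x^perp, given by a symmetric matrix S of quadrics
   in x, and the branch curve is its discriminant x adj(S) x^T, a sextic.
   After moving X by GL_3 the branch curve is the fixed curve f = 0, and then
   the discriminant is a multiple of f: some power of it is divisible by f, and
   differentiation (f being smooth) keeps the defect of divisibility bounded for
   all powers.

   The quadratic system disc S = f is unramified.  Let S' be apolar to S, let
   [x] be the matrix of the cross product with x, and put W = [x] S [x] and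
   M = W S' [x].  Along f = 0 the matrix W has rank one and M = b W; since a
   smooth plane curve is projectively normal, b may be taken to be a polynomial,
   and comparing degrees gives M = b W everywhere, whence [x] S' [x] = 0.

   A quadratic system B(p, p) = f with injective differential at every solution
   has finitely many solutions: (p - q) is killed by B(p + q, -), so a minor of
   B(p + q, -) separates p from all other solutions q, and these minors have
   bounded degree. *)

From HB Require Import structures.
Require Import Defs.
From mathcomp Require Import all_boot all_order all_algebra.
From mathcomp Require Import classical_sets cardinality reals.
From mathcomp Require Import complex.
From mathcomp Require Import finmap mpoly boolp functions ring lra.

Set Implicit Arguments.
Unset Strict Implicit.
Unset Printing Implicit Defensive.

Import Order.TTheory GRing.Theory Num.Theory.

Local Open Scope ring_scope.

(** * Cross products and discriminants *)

Section CrossProduct.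
Variable R : comNzRingType.
Implicit Types (x : 'I_3 -> R) (S T : 'M[R]_3).

(* [crossmx x] maps a column [v] to the cross product of [x] and [v]. *)
Definition crossmx x : 'M[R]_3 :=
  \matrix_(i, j)
    if j == i then 0 else if j == i + 1 then - x (i + 2%:R) else x (i + 1).

(* The polar form of S |-> x adj(S) x^T, without the factor 1/2: [bdisc x S S]
   is twice x adj(S) x^T. *)
Definition bdisc x S T : R :=
  \sum_i \sum_j x i * x j *
   (S (i + 1) (j + 1) * T (i + 2%:R) (j + 2%:R)
    + T (i + 1) (j + 1) * S (i + 2%:R) (j + 2%:R)
    - S (i + 1) (j + 2%:R) * T (i + 2%:R) (j + 1)
    - T (i + 1) (j + 2%:R) * S (i + 2%:R) (j + 1)).

(* Up to sign, the Gram matrix of the restriction of [S] to the orthogonal of x,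
   with respect to the rows of [crossmx x]. *)
Definition sandwich x S := crossmx x *m S *m crossmx x.

Lemma sum3 (F : 'I_3 -> R) : \sum_i F i = F 0 + F 1 + F 2%:R.
Proof.
rewrite !big_ord_recl big_ord0 addr0 addrA.
by congr (F _ + F _ + F _); apply: val_inj.
Qed.

Lemma ord3_ind (P : 'I_3 -> Prop) : P 0 -> P 1 -> P 2%:R -> forall i, P i.
Proof.
by move=> p0 p1 p2 [[|[|[|//]]] lt3]; [move: p0|move: p1|move: p2];
  congr P; apply: val_inj.
Qed.

(** Indices in ['I_3] add modulo 3; these values bring cyclic indices back to the literals that
    [crossmxE] and [sym3E] match. *)
Lemma add3E : ((0 + 1)%R = 1%R :> 'I_3) * ((0 + 2%:R)%R = 2%:R%R :> 'I_3)
  * ((1 + 1)%R = 2%:R%R :> 'I_3) * ((1 + 2%:R)%R = 0%R :> 'I_3)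
  * ((2%:R + 1)%R = 0%R :> 'I_3) * ((2%:R + 2%:R)%R = 1%R :> 'I_3).
Proof. by do !split; apply: val_inj. Qed.

Lemma crossmxE x :
  (crossmx x 0%R 0%R = 0%R) * (crossmx x 1%R 1%R =
    0%R) * (crossmx x 2%:R%R 2%:R%R = 0%R)
  * (crossmx x 0%R 1%R = (- x 2%:R)%R) * (crossmx x 1%R 2%:R%R = (- x 0)%R)
  * (crossmx x 2%:R%R 0%R = (- x 1)%R) * (crossmx x 1%R 0%R = x 2%:R%R)
  * (crossmx x 2%:R%R 1%R = x 0%R) * (crossmx x 0%R 2%:R%R = x 1%R).
Proof. by do !split; rewrite mxE /= ?add3E. Qed.

Lemma sym3E S : S^T = S ->
  (S 1%R 0%R = S 0%R 1%R) * (S 2%:R%R 0%R = S 0%R 2%:R%R)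
  * (S 2%:R%R 1%R = S 1%R 2%:R%R).
Proof. by move=> sS; do !split; rewrite -{1}sS mxE. Qed.

Lemma mulmx3E S T i j :
  (S *m T) i j = S i 0 * T 0 j + S i 1 * T 1 j + S i 2%:R * T 2%:R j.
Proof. by rewrite mxE sum3. Qed.

Lemma bdisc3E x S T : S^T = S -> T^T = T -> bdisc x S T =
  x 0 ^+ 2 * (S 1 1 * T 2%:R 2%:R + T 1 1 * S 2%:R 2%:R
              - S 1 2%:R * T 1 2%:R *+ 2)
  + x 1 ^+ 2 * (S 0 0 * T 2%:R 2%:R + T 0 0 * S 2%:R 2%:R
              - S 0 2%:R * T 0 2%:R *+ 2)
  + x 2%:R ^+ 2 * (S 0 0 * T 1 1 + T 0 0 * S 1 1 - S 0 1 * T 0 1 *+ 2)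
  + (x 0 * x 1 * (S 0 2%:R * T 1 2%:R + T 0 2%:R * S 1 2%:R
               - S 0 1 * T 2%:R 2%:R - T 0 1 * S 2%:R 2%:R)
    + x 0 * x 2%:R * (S 0 1 * T 1 2%:R + T 0 1 * S 1 2%:R
               - S 0 2%:R * T 1 1 - T 0 2%:R * S 1 1)
    + x 1 * x 2%:R * (S 0 1 * T 0 2%:R + T 0 1 * S 0 2%:R
               - S 0 0 * T 1 2%:R - T 0 0 * S 1 2%:R)) *+ 2.
Proof.
by move=> /sym3E sS /sym3E sT; rewrite /bdisc !sum3 !add3E !sS !sT; ring.
Qed.

(** Polarisation of [[x] S [x] S [x] = - (x adj(S) x^T) [x]], a form of Cayley-Hamilton for the
    traceless matrix [[x] S]; checked entry by entry. *)
Lemma sandwich_anticomm x S T : S^T = S -> T^T = T ->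
  sandwich x S *m T *m crossmx x + sandwich x T *m S *m crossmx x =
  - bdisc x S T *: crossmx x.
Proof.
move=> sS sT; rewrite bdisc3E // /sandwich.
move: (crossmxE x) (sym3E sS) (sym3E sT); move: (crossmx x) => X XE {}sS {}sT.
apply/matrixP=> i j; rewrite [LHS]mxE [RHS]mxE !mulmx3E.
by move: i j; elim/ord3_ind; elim/ord3_ind; rewrite !XE ?sS ?sT; ring.
Qed.

(** This is what gives [[x] S [x]] rank at most one along the discriminant curve. *)
Lemma sandwich_minor x S i j k l : S^T = S ->
  2%:R * (sandwich x S i j * sandwich x S k l - sandwich x S i l * sandwich x
    S k j) =
  bdisc x S S * crossmx x i k * crossmx x j l.
Proof.
move=> sS; rewrite bdisc3E // /sandwich.
move: (crossmxE x) (sym3E sS); move: (crossmx x) => X XE {}sS.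
rewrite !mulmx3E.
by move: i j k l; elim/ord3_ind; elim/ord3_ind; elim/ord3_ind; elim/ord3_ind;
  rewrite !XE ?sS; ring.
Qed.
End CrossProduct.

(** * Ideals and homogeneous polynomials *)

Section Ideals.
Variable R : comNzRingType.

Record is_ideal (J : R -> Prop) : Prop := IsIdeal {
  ideal_zero : J 0;
  ideal_add : forall p q, J p -> J q -> J (p + q);
  ideal_mull : forall r p, J p -> J (r * p) }.

Definition ideal_gen (I : finType) (F : I -> R) (p : R) :=
  exists c : I -> R, p = \sum_i c i * F i.

Lemma ideal_genP (I : finType) (F : I -> R) : is_ideal (ideal_gen F).
Proof.
split.
- by exists (fun=> 0); rewrite big1 // => i _; rewrite mul0r.
- move=> _ _ [c ->] [d ->]; exists (fun i => c i + d i).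
  by rewrite -big_split; apply: eq_bigr => i _; rewrite mulrDl.
- move=> r _ [c ->]; exists (fun i => r * c i).
  by rewrite mulr_sumr; apply: eq_bigr => i _; rewrite mulrA.
Qed.

Lemma ideal_gen_mem (I : finType) (F : I -> R) i : ideal_gen F (F i).
Proof.
exists (fun j => (j == i)%:R); rewrite (bigD1 i) //= eqxx mul1r big1 ?addr0 //.
by move=> j /negbTE->; rewrite mul0r.
Qed.

Definition mult_of (f p : R) := exists g, p = f * g.

Lemma mult_ofP f : is_ideal (mult_of f).
Proof.
split; first by exists 0; rewrite mulr0.
- by move=> _ _ [g ->] [h ->]; exists (g + h); rewrite mulrDr.
- by move=> r _ [g ->]; exists (r * g); rewrite mulrCA.
Qed.

Variables (J : R -> Prop) (idJ : is_ideal J).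

Lemma ideal_mulr r p : J p -> J (p * r).
Proof. by rewrite mulrC; apply: ideal_mull. Qed.

Lemma ideal_opp p : J p -> J (- p).
Proof. by rewrite -mulN1r; apply: ideal_mull. Qed.

Lemma ideal_sub p q : J p -> J q -> J (p - q).
Proof. by move=> Jp /ideal_opp; apply: ideal_add. Qed.

Lemma ideal_sum (I : finType) (F : I -> R) :
  (forall i, J (F i)) -> J (\sum_i F i).
Proof. by move=> JF; elim/big_ind: _ => //; [case: idJ | apply: ideal_add]. Qed.

End Ideals.

(** * Homogeneous polynomials and divisibility by variables *)

Section Polynomials.
Variables (n : nat) (K : fieldType).
Implicit Types (p q f g h b u v : {mpoly K[n]}) (i j : 'I_n).

Lemma mderivXU i j : mderiv i ('X_j : {mpoly K[n]}) = (i == j)%:R.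
Proof.
rewrite mderivX mnm1E eq_sym; case: eqVneq => [->|_]; last by rewrite scale0r.
by rewrite -[X in (X - _)%MM]add0m addmK mpolyX0 scale1r.
Qed.

Lemma mderiv_exp i p k : mderiv i (p ^+ k.+1) = p ^+ k * mderiv i p *+ k.+1.
Proof.
elim: k => [|k IH]; first by rewrite expr1 expr0 mul1r.
by rewrite exprS mderivM {}IH mulrnAr mulrA -exprS mulrC [in RHS]mulrS.
Qed.

Lemma submU1K i (m : 'X_{1..n}) : (0 < m i)%N -> (m - U_(i) + U_(i) = m)%MM.
Proof.
by move=> mi; rewrite submK //; apply/mnm_lepP => j; rewrite mnm1E;
  case: eqP => // <-.
Qed.

Lemma euler_homog d p : p \is d.-homog -> \sum_i 'X_i * mderiv i p = p *+ d.
Proof.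
move=> /dhomogP homp; rewrite {2}[p]mpolyE.
under eq_bigr => i _ do rewrite {1}[p]mpolyE raddf_sum mulr_sumr /=.
rewrite exchange_big -sumrMnl /= big_seq [RHS]big_seq; apply: eq_bigr => m pm.
have -> : d = (\sum_i m i)%N by rewrite -mdegE; apply/esym/homp.
rewrite -sumrMnr; apply: eq_bigr => i _.
rewrite mderivZ mderivX -!scalerAr.
have [->|mi] := posnP (m i); first by rewrite scale0r scaler0.
by rewrite -mpolyXD addmC submU1K // scaler_nat scalerMnr.
Qed.

Lemma mderiv_homog d i p : p \is d.+1.-homog -> mderiv i p \is d.-homog.
Proof.
move=> /dhomogP homp; rewrite [p]mpolyE raddf_sum /=.
rewrite big_seq; apply: rpred_sum => m pm; rewrite mderivZ mderivX.
have [->|mi] := posnP (m i); first by rewrite scale0r scaler0 rpred0.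
do 2!apply: rpredZ; rewrite dhomogX /= -(eqn_add2r 1) -(mdeg1 i) -mdegD.
by rewrite submU1K // homp // mdeg1 addn1.
Qed.

Lemma homog0_const p : p \is 0.-homog -> p = (p@_0)%:MP.
Proof.
move=> /dhomogP homp; apply/mpolyP => m; rewrite mcoeffC.
case: eqVneq => [->|m0]; first by rewrite mulr1.
rewrite mulr0; apply: memN_msupp_eq0; apply: contra m0 => /homp.
by rewrite -mdeg_eq0 => ->.
Qed.

(** Serves to take graded pieces of a congruence modulo a form: the cofactor is replaced by one of
    its homogeneous components. *)
Lemma pihomogM d e p q : p \is d.-homog ->
  pihomog mdeg (d + e) (p * q) = p * pihomog mdeg e q.
Proof.
move=> homp; pose k := maxn (msize q) e.+1.
rewrite {1}(@pihomog_partitionE _ _ mdeg k q) ?leq_maxl //.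
rewrite mulr_sumr raddf_sum /=.
have ek : (e < k)%N by rewrite leq_maxr.
rewrite (bigD1 (Ordinal ek)) //= big1 ?addr0 => [|b ne].
  by rewrite pihomog_dE // dhomogM // pihomogP.
rewrite (@pihomog_ne0 _ _ mdeg (d + b)) ?dhomogM ?pihomogP //.
by rewrite eqn_add2l.
Qed.

(** Substitution of 0 for ['X_i], as an idempotent endomorphism of the same ring; it models
    restriction to a coordinate hyperplane. *)
Definition kill_tuple i : n.-tuple {mpoly K[n]} :=
  [tuple if j == i then 0 else 'X_j | j < n].

Local Notation kill_var i p := (comp_mpoly (kill_tuple i) p).

Lemma kill_varX i j : kill_var i 'X_j = if j == i then 0 else 'X_j.
Proof. by rewrite comp_mpolyXU -tnth_nth tnth_mktuple. Qed.

Lemma kill_var_mod i p : mult_of 'X_i (p - kill_var i p).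
Proof.
have idX := mult_ofP ('X_i : {mpoly K[n]}).
elim/mpolyind: p => [|c m p _ _ IH]; first by rewrite raddf0 subrr; case: idX.
rewrite raddfD /= opprD addrACA; apply: ideal_add => //.
rewrite comp_mpolyZ -scalerBr -mul_mpolyC.
apply: ideal_mull => //; rewrite comp_mpolyX.
have [mi|mi] := posnP (m i).
  suff -> : 'X_[m] = \prod_(j < n) tnth (kill_tuple i) j ^+ m j.
    by rewrite subrr; case: idX.
  rewrite mpolyXE_id; apply: eq_bigr => j _.
  by rewrite tnth_mktuple; case: eqP => // ->; rewrite mi.
exists 'X_[m - U_(i)]; rewrite (bigD1 i) //= tnth_mktuple eqxx expr0n.
by rewrite eqn0Ngt mi mul0r subr0 -mpolyXD addmC submU1K.
Qed.

Lemma kill_var_eq0 i p : kill_var i p = 0 -> mult_of 'X_i p.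
Proof. by move=> p0; have := kill_var_mod i p; rewrite p0 subr0. Qed.

Lemma kill_var_id i p : kill_var i (kill_var i p) = kill_var i p.
Proof.
have [g /(congr1 (comp_mpoly (kill_tuple i)))] := kill_var_mod i p.
rewrite raddfB rmorphM /= kill_varX eqxx mul0r => /eqP.
by rewrite subr_eq0 => /eqP.
Qed.

Lemma mpolyX_neq0 i : 'X_i != 0 :> {mpoly K[n]}.
Proof. by rewrite -msize_poly_eq0 msizeX. Qed.

(** Setting ['X_i] to 0 kills the right side but not the power of ['X_j], so ['X_i] divides [u];
    induction on [N] does the rest. *)
Lemma var_pow_dvd i j N N' u v : i != j ->
  'X_j ^+ N' * u = 'X_i ^+ N * v -> mult_of ('X_i ^+ N) u.
Proof.
move=> ij; elim: N u => [|N IH] u eq_uv; first by exists u; rewrite mul1r.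
have : kill_var i u = 0.
  move/(congr1 (comp_mpoly (kill_tuple i))): eq_uv.
  rewrite !rmorphM !rmorphXn /= !kill_varX eqxx eq_sym (negbTE ij) expr0n mul0r.
  by move/eqP; rewrite mulf_eq0 expf_eq0 (negbTE (mpolyX_neq0 _)) andbF => /eqP.
case/kill_var_eq0 => u1 def_u; case: (IH u1) => [|u2 def_u1].
  apply: (mulfI (mpolyX_neq0 i)).
  by rewrite mulrCA -def_u eq_uv exprS mulrA.
by exists u2; rewrite def_u def_u1 exprS mulrA.
Qed.

(* The homogeneous coordinate ring of a hypersurface has depth at least 1. *)
Lemma saturated i j N N' h b : i != j -> h != 0 ->
  mult_of h ('X_i ^+ N * b) -> mult_of h ('X_j ^+ N' * b) -> mult_of h b.
Proof.
move=> ij h0 [u eu] [v ev].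
case: (@var_pow_dvd i j N N' u v ij) => [|u1 def_u].
  by apply: (mulfI h0); rewrite mulrCA -eu mulrCA ev [RHS]mulrCA.
exists u1; have X0 : 'X_i ^+ N != 0 :> {mpoly K[n]}.
  by rewrite expf_eq0 negb_and mpolyX_neq0 orbT.
by apply: (mulfI X0); rewrite eu def_u mulrCA.
Qed.
End Polynomials.

(** * Rigidity of the discriminant *)

Section Apolarity.
Variable R : comNzRingType.
Implicit Types (x : 'I_3 -> R) (S T : 'M[R]_3).

Lemma trmx_crossmx x : (crossmx x)^T = - crossmx x.
Proof.
apply/matrixP=> i j; rewrite [LHS]mxE [RHS]mxE; move: i j.
by elim/ord3_ind; elim/ord3_ind; rewrite !crossmxE ?oppr0 ?opprK.
Qed.

Lemma crossmx_mul x : crossmx x *m \col_i x i = 0.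
Proof.
apply/matrixP=> i j; rewrite mxE sum3 !mxE.
by move: i; elim/ord3_ind; rewrite /= ?add3E; ring.
Qed.

Lemma trmx_sandwich x S : S^T = S -> (sandwich x S)^T = sandwich x S.
Proof.
move=> sS; rewrite /sandwich !trmx_mul trmx_crossmx sS.
by rewrite mulmxN mulNmx mulmxN opprK mulmxA.
Qed.

(** Modulo [J] the matrix [W] has rank one, so the columns of [W Y] are proportional to those of
    [W]: this is [swap]. Two such exchanges, joined by the symmetry of both matrices, give the
    claim. *)
Lemma rank_one_minor (J : R -> Prop) n (W Y : 'M[R]_n) : is_ideal J ->
  (forall i j k l, J (W i j * W k l - W i l * W k j)) ->
  W^T = W -> (W *m Y)^T = W *m Y ->
  forall i j k l, J ((W *m Y) i j * W k l - (W *m Y) k l * W i j).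
Proof.
move=> idJ minorW symW symWY i j k l.
have swap a b c d : J ((W *m Y) a b * W c d - (W *m Y) c b * W a d).
  rewrite !mxE !mulr_suml -sumrB; apply: ideal_sum => // e.
  have -> : W a e * Y e b * W c d - W c e * Y e b * W a d =
    (W a e * W c d - W a d * W c e) * Y e b by ring.
  exact/(ideal_mulr idJ)/minorW.
have symE (A : 'M[R]_n) a b : A^T = A -> A a b = A b a.
  by move=> sA; rewrite -{1}sA mxE.
have /(ideal_add idJ (swap i j k l)) := swap j k l i.
rewrite (symE W l i) // (symE (W *m Y) j k) // (symE W j i) //.
by rewrite (symE (W *m Y) l k) // addrA subrK.
Qed.

(** Apolarity makes the anticommutator of [sandwich_anticomm] vanish, and transposition turns one of
    its two terms into minus the other. *)
Lemma trmx_apolar x S T : S^T = S -> T^T = T -> bdisc x S T = 0 ->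
  (sandwich x S *m (T *m crossmx x))^T = sandwich x S *m (T *m crossmx x).
Proof.
move=> sS sT d0; have := sandwich_anticomm x sS sT; rewrite d0 oppr0 scale0r.
move/eqP; rewrite addr_eq0 mulmxA => /eqP eM; rewrite [RHS]eM.
rewrite trmx_mul trmx_crossmx [(_ *m T)^T]trmx_mul sT trmx_sandwich //
  /sandwich.
by rewrite !mulNmx !mulmxA.
Qed.

Lemma sandwich_mul_var x S : sandwich x S *m \col_i x i = 0.
Proof. by rewrite /sandwich -!mulmxA crossmx_mul !mulmx0. Qed.
End Apolarity.

(** Multiplying the equation on the left by [2 [x] S] and cancelling the discriminant gives [[x] T
    [x] = b [x]]. The left side is symmetric and the right side antisymmetric, so both vanish. *)
Lemma sandwich_cancel (R : idomainType) (x : 'I_3 -> R) (S T : 'M[R]_3) b :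
  (2%:R : R) != 0 -> S^T = S -> T^T = T -> bdisc x S S != 0 ->
  sandwich x S *m (T *m crossmx x) = b *: sandwich x S -> sandwich x T = 0.
Proof.
move=> nz2 symS symT nzf eM.
have WW : 2%:R *: (crossmx x *m S *m sandwich x S) = - bdisc x S S *: crossmx x.
  by rewrite -sandwich_anticomm // -mulr2n scaler_nat /sandwich !mulmxA.
have TX : sandwich x T = b *: crossmx x.
  have e : - bdisc x S S *: sandwich x T = - bdisc x S S *: (b *: crossmx x).
    have := congr1 (fun A => 2%:R *: (crossmx x *m S *m A)) eM.
    rewrite /= mulmxA scalemxAl WW -scalemxAl mulmxA -/(sandwich x T) => ->.
    by rewrite -scalemxAr scalerA mulrC -scalerA WW scalerA mulrC -scalerA.
  apply/matrixP => i j; move/matrixP/(_ i j): e; rewrite [LHS]mxE [RHS]mxE.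
  by apply: mulfI; rewrite oppr_eq0.
have := trmx_sandwich x symT;
  rewrite {1}TX linearZ /= trmx_crossmx scalerN -TX => e2.
apply/matrixP => i j; move/matrixP/(_ i j): e2; rewrite [LHS]mxE => e2.
rewrite [RHS]mxE; move/eqP: e2;
  rewrite eq_sym -addr_eq0 -mulr2n -mulr_natl mulf_eq0 (negbTE nz2) /=.
by move/eqP.
Qed.

Section Rigidity.
Variable K : fieldType.
Local Notation P := {mpoly K[3]}.
Local Notation X := (fun i : 'I_3 => 'X_i : P).
Local Notation kill_var i p := (comp_mpoly (kill_tuple K i) p).

(** The coefficients [c i j k] are symmetric in [i, j] and, by two differentiations of the relation
    [Psi x = 0], antisymmetric in [j, k]; such a tensor is zero when 2 is invertible. *)
Lemma linear_sym_eq0 (Psi : 'M[P]_3) : (2%:R : K) != 0 ->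
  (forall i j, Psi i j \is 1.-homog) -> Psi^T = Psi ->
  Psi *m \col_i X i = 0 -> Psi = 0.
Proof.
move=> nz2 hom1 sPsi PsiX.
pose c i j k := mderiv k (Psi i j).
have dc i j k l : mderiv l (c i j k) = 0.
  by rewrite /c (homog0_const (mderiv_homog k (hom1 i j))) mderivC.
have csym i j k : c i j k = c j i k by rewrite /c -{1}sPsi mxE.
have d_nat l (m : nat) : mderiv l (m%:R : P) = 0.
  by rewrite -mpolyC_nat mderivC.
have canti i k l : c i l k = - c i k l.
  have dd j : mderiv l (mderiv k (Psi i j * 'X_j)) =
      c i j k * (j == l)%:R + c i j l * (j == k)%:R.
    rewrite mderivM mderivD !mderivM -/(c i j k) -/(c i j l) dc !mderivXU d_nat.
    by rewrite mulr0 addr0 mul0r add0r ![_ == j]eq_sym.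
  apply/eqP; rewrite -addr_eq0; apply/eqP.
  move/matrixP/(_ i 0): PsiX; rewrite !mxE.
  move/(congr1 (mderiv k))/(congr1 (mderiv l)).
  rewrite (raddf_sum (mderiv k)) (raddf_sum (mderiv l)) mderiv0 mderiv0.
  under eq_bigr => j _ do rewrite mxE /= dd.
  rewrite big_split /= (bigD1 l) //= eqxx mulr1 big1; last first.
    by move=> j /negbTE->; rewrite mulr0.
  rewrite (bigD1 k) //= eqxx mulr1 big1 ?addr0 //.
  by move=> j /negbTE->; rewrite mulr0.
have c0 i j k : c i j k = 0.
  have : c i j k = - c i j k.
    by rewrite {1}csym canti csym canti opprK csym canti.
  move/eqP; rewrite -addr_eq0 -mulr2n -scaler_nat scaler_eq0 (negbTE nz2) /=.
  by move/eqP.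
apply/matrixP => i j; rewrite mxE -[LHS]mulr1n -(euler_homog (hom1 i j)).
by rewrite big1 // => k _; rewrite -/(c i j k) c0 mulr0.
Qed.

Lemma crossmx_homog i j : crossmx X i j \is [in K[3], 1.-homog].
Proof.
rewrite mxE; case: ifP => _; first exact: rpred0.
case: ifP => _.
  by rewrite rpredN dhomogX /= mdeg1.
by rewrite dhomogX /= mdeg1.
Qed.

Lemma mulmx_homog d e m n p (A : 'M[P]_(m, n)) (B : 'M[P]_(n, p)) :
  (forall i j, A i j \is d.-homog) -> (forall i j, B i j \is e.-homog) ->
  forall i j, (A *m B) i j \is (d + e).-homog.
Proof.
move=> hA hB i j; rewrite mxE; apply: rpred_sum => k _.
by rewrite dhomogM ?hA ?hB.
Qed.

Section Rigid.
Variables (f : P) (S T : 'M[P]_3).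
Hypotheses (nz2 : (2%:R : K) != 0) (symS : S^T = S) (symT : T^T = T).
Hypotheses (homS : forall i j, S i j \is 2.-homog).
Hypotheses (homT : forall i j, T i j \is 2.-homog).
Hypotheses (discS : bdisc X S S = f) (discST : bdisc X S T = 0).
Hypothesis f_homog : f \is 6.-homog.
Hypothesis kill_f : kill_var 2%:R f != 0.
Hypothesis smooth_f : forall i,
  exists N, ideal_gen (fun l => mderiv l f) ('X_i ^+ N).

(* Variables rather than local definitions: unification must not unfold them. *)
Variables W M : 'M[P]_3.
Hypotheses (defW : W = sandwich X S) (defM : M = W *m (T *m crossmx X)).

Let f_neq0 : f != 0.
Proof. by apply: contraNneq kill_f => ->; rewrite comp_mpoly0. Qed.

Let symW : W^T = W.
Proof. by rewrite defW; exact: trmx_sandwich. Qed.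

Let symM : M^T = M.
Proof. by rewrite defM defW; exact: trmx_apolar. Qed.

Let half : P := (2%:R^-1 : K)%:MP.

Let halfK (p : P) : half * (2%:R * p) = p.
Proof. by rewrite mulrA -mpolyC_nat -mpolyCM mulVf // mpolyC1 mul1r. Qed.

Let W_minor i j k l :
  W i j * W k l - W i l * W k j = f * (half * (crossmx X i k * crossmx X j l)).
Proof. by rewrite -[LHS]halfK defW sandwich_minor // discS; ring. Qed.

Let M_minor i j k l : mult_of f (M i j * W k l - M k l * W i j).
Proof.
have symWT : (W *m (T *m crossmx X))^T = W *m (T *m crossmx X).
  by rewrite -defM.
rewrite defM; apply: (rank_one_minor (mult_ofP f) _ symW symWT).
by move=> a b c d; rewrite W_minor; eexists.
Qed.

(** A common zero of the entries of [W] would be singular on f = 0: [f * 'X_i ^+ 2] is a combination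
    of products of two entries, so its derivatives stay in the ideal [J] of the entries, and
    smoothness provides a power of ['X_i]. *)
Let W_irrelevant i :
  exists N, ideal_gen (fun kl : 'I_3 * 'I_3 => W kl.1 kl.2) ('X_i ^+ N).
Proof.
pose J := ideal_gen (fun kl : 'I_3 * 'I_3 => W kl.1 kl.2).
have idJ : is_ideal J := ideal_genP _.
have JW k l : J (W k l) := ideal_gen_mem (fun kl => W kl.1 kl.2) (k, l).
have fX2 : f * 'X_i ^+ 2 =
    2%:R * (W (i + 1) (i + 1) * W (i + 2%:R) (i + 2%:R)
          - W (i + 1) (i + 2%:R) * W (i + 2%:R) (i + 1)).
  rewrite defW sandwich_minor // discS; move: i.
  by elim/ord3_ind; rewrite !add3E !crossmxE; ring.
have JfX2 : J (f * 'X_i ^+ 2).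
  by rewrite fX2; apply: ideal_mull => //; apply: ideal_sub => //;
    apply: ideal_mull.
have Jdf l : J ('X_i ^+ 3 * mderiv l f).
  have Jd : J ('X_i * mderiv l (f * 'X_i ^+ 2)).
    apply: ideal_mull => //; rewrite fX2 -mpolyC_nat mderiv_mulC.
    apply: ideal_mull => //; rewrite mderivB !mderivM.
    apply: (ideal_sub idJ); apply: (ideal_add idJ);
      by [exact: (ideal_mull idJ) | exact: (ideal_mulr idJ)].
  (* The extra factor ['X_i] makes the error term of the Leibniz rule a multiple of [f * 'X_i ^+ 2],
     already in [J]. *)
  have -> : 'X_i ^+ 3 * mderiv l f = 'X_i * mderiv l (f * 'X_i ^+ 2)
     - (mderiv l 'X_i *+ 2) * (f * 'X_i ^+ 2).
    by rewrite mderivM mderiv_exp; ring.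
  by apply: ideal_sub => //; apply: ideal_mull.
have [N [c XN]] := smooth_f i; exists (N + 3)%N; rewrite -/J exprD XN mulr_suml.
apply: ideal_sum => // l; rewrite -mulrA [mderiv _ _ * _]mulrC.
exact: ideal_mull.
Qed.

(* Projective normality of the curve f = 0: setting 'X_2 to 0 shows that [b] is
   divisible by 'X_2 modulo f. *)
Let M_lift n : (exists b, forall i j,
  mult_of f ('X_2%:R ^+ n * M i j - b * W i j)) ->
  exists b, forall i j, mult_of f (M i j - b * W i j).
Proof.
have idf := mult_ofP f.
elim: n => [|n IH] [b bP]; first by exists b => i j; have := bP i j;
  rewrite expr0 mul1r.
apply: IH.
pose fbar := kill_var 2%:R f; pose bbar := kill_var 2%:R b.
have bW i j : mult_of fbar (bbar * kill_var 2%:R (W i j)).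
  have [g /(congr1 (comp_mpoly (kill_tuple K 2%:R)))] := bP i j.
  rewrite rmorphB !rmorphM rmorphXn /= kill_varX eqxx expr0n mul0r sub0r.
  by move/(canRL opprK) ->; rewrite -mulrN; eexists.
(* On the line ['X_2 = 0], [bbar] maps every entry of [W] into [(fbar)], and these entries generate
   powers of ['X_0] and ['X_1]; saturation then puts [bbar] itself in [(fbar)]. *)
have Xb i : i != 2%:R -> exists N, mult_of fbar ('X_i ^+ N * bbar).
  move=> i2; have [N [c XN]] := W_irrelevant i; exists N.
  have := congr1 (comp_mpoly (kill_tuple K 2%:R)) XN.
  rewrite rmorphXn /= kill_varX (negbTE i2) => ->.
  rewrite rmorph_sum mulr_suml; apply: (ideal_sum (mult_ofP _)) => kl.
  rewrite rmorphM /= -mulrA; apply: (ideal_mull (mult_ofP _)).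
  by rewrite mulrC.
have [N0 X0b] := Xb 0 isT; have [N1 X1b] := Xb 1 isT.
have [h def_b] := saturated (isT : 0 != 1 :> 'I_3) kill_f X0b X1b.
have [|b1 def_b1] := @kill_var_eq0 _ K 2%:R (b - f * h).
  by rewrite rmorphB rmorphM /= -[kill_var _ b]kill_var_id -/bbar def_b
    rmorphM /=
       kill_var_id subrr.
exists b1 => i j.
have [g gE] : mult_of f ('X_2%:R * ('X_2%:R ^+ n * M i j - b1 * W i j)).
  have -> : 'X_2%:R * ('X_2%:R ^+ n * M i j - b1 * W i j)
    = ('X_2%:R ^+ n.+1 * M i j - b * W i j) + f * (h * W i j).
    by rewrite mulrBr mulrA -exprS mulrA -def_b1; ring.
  by apply: ideal_add => //; exists (h * W i j).
(* As [f] does not vanish on ['X_2 = 0], the factor ['X_2] must divide the cofactor [g], and can be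
   cancelled. *)
have [|g1 def_g] := @kill_var_eq0 _ K 2%:R g.
  have /eqP := congr1 (comp_mpoly (kill_tuple K 2%:R)) gE.
  by rewrite !rmorphM /= kill_varX eqxx mul0r eq_sym mulf_eq0 (negbTE kill_f)
    => /eqP.
by exists g1; apply: (mulfI (mpolyX_neq0 K 2%:R)); rewrite gE def_g mulrCA.
Qed.

Theorem apolar_eq0 : sandwich X T = 0.
Proof.
have [b bP] : exists b, forall i j, mult_of f (M i j - b * W i j).
  (* Writing ['X_2 ^+ N] as a combination of the entries of [W], the same combination of the entries
     of [M] serves as [b], by the relations [M_minor]. *)
  have [N [c XN]] := W_irrelevant 2%:R; apply: (M_lift (n := N)).
  exists (\sum_kl c kl * M kl.1 kl.2) => i j; rewrite XN !mulr_suml -sumrB.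
  apply: (ideal_sum (mult_ofP f)) => kl.
  rewrite -!mulrA -mulrBr mulrC; apply: (ideal_mulr (mult_ofP f)).
  by rewrite [W kl.1 kl.2 * _]mulrC.
have homW i j : W i j \is 4.-homog.
  rewrite defW; exact: (mulmx_homog (mulmx_homog crossmx_homog homS)
    crossmx_homog).
have homM i j : M i j \is 7.-homog.
  rewrite defM; exact: (mulmx_homog homW (mulmx_homog homT crossmx_homog)).
(* [M] has degree 7, [W] degree 4 and [f] degree 6, so [b] may be taken cubic and the cofactor [Psi]
   linear. *)
pose b3 := pihomog mdeg 3 b.
have [Psi PsiE] : exists Psi : 'M[P]_3,
   forall i j, Psi i j \is 1.-homog /\ M i j - b3 * W i j = f * Psi i j.
  have [psi psiP] := choice (fun ij : 'I_3 * 'I_3 => bP ij.1 ij.2).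
  exists (\matrix_(i, j) pihomog mdeg 1 (psi (i, j))) => i j.
  rewrite mxE; split; first exact: pihomogP.
  have /(congr1 (pihomog mdeg 7)) := psiP (i, j).
  rewrite (pihomogM (d := 6) 1) // raddfB /= pihomog_dE //.
  by rewrite [b * _]mulrC (pihomogM (d := 4) 3) // [_ * b3]mulrC.
(* [Psi] inherits symmetry and the relation [Psi x = 0] from [M] and [W], after cancelling [f]. *)
have Psi0 : Psi = 0.
  apply: linear_sym_eq0 => //; first by move=> i j; case: (PsiE i j).
    apply/matrixP => i j; rewrite mxE; apply: (mulfI f_neq0).
    case: (PsiE i j) (PsiE j i) => _ <- [_ <-].
    by rewrite -{1}symM -{1}symW !mxE.
  apply/matrixP => i j; rewrite mxE [RHS]mxE; apply: (mulfI f_neq0).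
  rewrite mulr0 mulr_sumr.
  under eq_bigr => k _ do rewrite mulrA -(proj2 (PsiE i k)).
  have : (M - b3 *: W) *m \col_i X i = 0.
    have Wx : W *m \col_i X i = 0 by rewrite defW sandwich_mul_var.
    have Mx : M *m \col_i X i = 0 by rewrite defM -2!mulmxA crossmx_mul !mulmx0.
    by rewrite mulmxBl -scalemxAl Wx Mx scaler0 subrr.
  move/matrixP/(_ i j); rewrite mxE [RHS]mxE => e0; rewrite -[RHS]e0.
  by apply: eq_bigr => k _; rewrite !mxE.
have MW : M = b3 *: W.
  apply/matrixP=> i j; rewrite [RHS]mxE; apply/eqP; rewrite -subr_eq0.
  by rewrite (proj2 (PsiE i j)) Psi0 mxE mulr0.
apply: (@sandwich_cancel _ X S T b3) => //.
- by rewrite -mpolyC_nat mpolyC_eq0.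
- by rewrite discS.
- by rewrite -defW -defM.
Qed.
End Rigid.
End Rigidity.

Local Open Scope classical_set_scope.

(** * The Nullstellensatz over an uncountable field *)

(* Nested intervals, the k-th of which avoids the point with code k. *)
Lemma realType_uncountable (R : realType) : ~ countable [set: R].
Proof.
move=> /countable_injP [e /in2TT einj].
(* If the point with code [k] exists and is at most the first third mark, the last third is kept,
   and otherwise the first third. *)
pose nxt k (p : R * R) :=
  if `[< exists2 x, e x = k & x <= (p.1 *+ 2 + p.2) / 3%:R >]
  then ((p.1 + p.2 *+ 2) / 3%:R, p.2) else (p.1, (p.1 *+ 2 + p.2) / 3%:R).
pose I := fix I k := if k is k.+1 then nxt k (I k) else (0, 1).
have I_step k : (I k).1 < (I k).2 ->
    [/\ (I k).1 <= (I k.+1).1, (I k.+1).2 <= (I k).2 & (I k.+1).1 < (I k.+1).2].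
  by rewrite /= /nxt; case: (I k) => a b /= ab; case: ifP => _ /=; split; lra.
have I_lt k : (I k).1 < (I k).2.
  by elim: k => [|k /I_step[]//]; rewrite ltr01.
have I1_le j k : (I j).1 <= (I (j + k)%N).1.
  elim: k => [|k /le_trans->//]; rewrite ?addn0 // addnS.
  by have [] := I_step _ (I_lt (j + k)%N).
have I2_le j k : (I (j + k)%N).2 <= (I j).2.
  elim: k => [|k]; first by rewrite addn0.
  by apply: le_trans; rewrite addnS; have [] := I_step _ (I_lt (j + k)%N).
have I12 j k : (I j).1 <= (I k).2.
  have := ltW (I_lt (j + k)%N); move/(le_trans (I1_le j k)).
  by move/le_trans; apply; rewrite addnC.
pose A := [set (I k).1 | k in [set: nat]]; pose s := sup A.
have As k : (I k).1 <= s.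
  by apply: ub_le_sup; [exists (I 0).2 => _ [j _ <-] | exists k].
have sI k : s <= (I k).2.
  by apply: ge_sup; [exists (I 0).1; exists 0%N | move=> _ [j _ <-]].
have := As (e s).+1; have := sI (e s).+1; have := I_lt (e s).
rewrite /= /nxt; case: (I _) => a b /= ab; case: asboolP => [[x /einj->]|nx] /=.
  by lra.
by move=> sm _; apply: nx; exists s.
Qed.

Section Nullstellensatz.
Variables (K : closedFieldType) (n : nat).
Implicit Types (p q d u : {mpoly K[n]}) (i : 'I_n).
Hypothesis K_uncountable : ~ countable [set: K].

(** Pigeonhole: a map from an uncountable set to a countable one has an infinite fibre. *)
Lemma exists_fibre_seq (T : countType) (phi : K -> T) :
  exists t, forall D, exists2 cs : seq K, uniq cs /\ size cs = D &
    forall c, c \in cs -> phi c = t.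
Proof.
have [t inf_t] : exists t, infinite_set [set c | phi c = t].
  apply: contrapT => /forallNP fin; apply: K_uncountable.
  have -> : [set: K] = \bigcup_(t in [set: T]) [set c | phi c = t].
    by apply/seteqP; split => // c _; exists (phi c).
  apply: bigcup_countable; first exact: countableP.
  by move=> t _; apply: finite_set_countable; have /contrapT := fin t.
exists t => D; have [B sB leD] := infinite_set_fset D inf_t.
exists (take D (enum_fset B)).
  by rewrite take_uniq ?fset_uniq // size_takel.
by move=> c /mem_take cB; apply: sB.
Qed.

(** There are more polynomials than monomials of degree less than [s], so the matrix of coefficients
    has a nonzero left kernel. *)
Lemma mpoly_dependence s D (F : 'I_D -> {mpoly K[n]}) :
  (#|{: 'X_{1..n < s}}| < D)%N -> (forall j, msize (F j) <= s)%N ->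
  exists2 a : 'I_D -> K, \sum_j a j *: F j = 0 & exists j, a j != 0.
Proof.
move=> ltD szF.
pose A : 'M[K]_(D, #|{: 'X_{1..n < s}}|) := 
    \matrix_(j, m) (F j)@_(@enum_val _ {: 'X_{1..n < s}} m).
have : kermx A != 0.
  rewrite kermx_eq0 /row_free neq_ltn; apply/orP; left.
  exact: leq_ltn_trans (rank_leq_col _) ltD.
case/rowV0Pn => a /sub_kermxP aA nza; exists (a 0).
  apply/mpolyP => m; rewrite mcoeff0 raddf_sum /=.
  under eq_bigr => j _ do rewrite mcoeffZ.
  have [ltm|lem] := ssrnat.ltnP (mdeg m) s.
    have := congr1 (fun B : 'rV_ _ => B 0 (enum_rank (BMultinom ltm))) aA.
    rewrite /= mxE [RHS]mxE => e0; rewrite -[RHS]e0.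
    by apply: eq_bigr => j _; rewrite mxE enum_rankK.
  rewrite big1 // => j _; rewrite memN_msupp_eq0 ?mulr0 //.
  exact: msize_mdeg_ge (leq_trans (szF j) lem).
apply: contrapT => /forallNP a0; case/eqP: nza; apply/rowP => j; rewrite mxE.
by apply/eqP/negPn/negP/a0.
Qed.

Definition adjoin (J : {mpoly K[n]} -> Prop) q p := exists u, J (p - u * q).

Lemma adjoinP J q : is_ideal J -> is_ideal (adjoin J q).
Proof.
move=> idJ; split.
- by exists 0; rewrite mul0r subr0; case: idJ.
- move=> p1 p2 [u1 J1] [u2 J2]; exists (u1 + u2).
  by rewrite mulrDl opprD addrACA; apply: ideal_add.
- move=> r p [u Ju]; exists (r * u); rewrite -mulrA -mulrBr.
  exact: ideal_mull.
Qed.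

Lemma adjoin_sub J q p : is_ideal J -> J p -> adjoin J q p.
Proof. by move=> idJ Jp; exists 0; rewrite mul0r subr0. Qed.

Lemma adjoin_mem J q : is_ideal J -> adjoin J q q.
Proof. by move=> [J0 _ _]; exists 1; rewrite mul1r subrr. Qed.

(* Otherwise d ^ N = u_c * ('X_i - c) mod J for every c; as K is uncountable,
   the u_c are linearly dependent, which yields a nonzero polynomial in 'X_i
   that multiplies d ^ N into J, and its linear factors can be removed. *)
Lemma exists_coordinate J d i : is_ideal J -> (forall N, ~ J (d ^+ N)) ->
  exists c : K, forall N, ~ adjoin J ('X_i - c%:MP) (d ^+ N).
Proof.
move=> idJ Jd; apply: contrapT => /forallNP noc.
have /choice[Nu NuP] : forall c : K, exists Nu : nat * {mpoly K[n]},
    J (d ^+ Nu.1 - Nu.2 * ('X_i - c%:MP)).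
  move=> c; have /existsNP[N /contrapT[u Ju]] := noc c.
  by exists (N, u).
(* Exponent and size of the cofactor take countably many values, so arbitrarily many [c] share the
   same [N] and [s]. *)
have [[N s] fib] := exists_fibre_seq (fun c => ((Nu c).1, msize (Nu c).2)).
have [cs [uniq_cs size_cs] csP] := fib #|{: 'X_{1..n < s}}|.+1.
set D := size cs in size_cs.
have cs_fib (j : 'I_D) : ((Nu cs`_j).1, msize (Nu cs`_j).2) = (N, s).
  exact/csP/mem_nth.
have [||a a_dep [j0 nz_a]] := @mpoly_dependence s D (fun j => (Nu cs`_j).2).
- by rewrite size_cs.
- by move=> j; have [_ ->] := cs_fib j.
pose inXi (p : {poly K}) : {mpoly K[n]} := (map_poly (@mpolyC n K) p).['X_i].
have inXiM (p1 p2 : {poly K}) :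
  inXi (p1 * p2) = inXi p1 * inXi p2 by rewrite /inXi rmorphM hornerM.
have inXi_lin c : inXi ('X - c%:P) = 'X_i - c%:MP.
  by rewrite /inXi rmorphB /= map_polyX map_polyC hornerXsubC.
(* Lagrange products: at [cs_j0] only the term [j0] of [p] survives, whence [p] is nonzero. *)
pose P j := \prod_(l < D | l != j) ('X - (cs`_l)%:P) : {poly K}.
pose p := \sum_j a j *: P j.
have nz_p : p != 0.
  apply/eqP => /(congr1 (fun r : {poly K} => r.[cs`_j0]));
    rewrite horner0 horner_sum.
  rewrite (bigD1 j0) //= big1 ?addr0 => [|j nej]; last first.
    rewrite hornerZ horner_prod (bigD1 j0) 1?eq_sym //=.
    by rewrite hornerXsubC subrr mul0r mulr0.
  rewrite hornerZ => /eqP; rewrite mulf_eq0 (negbTE nz_a) /= horner_prod.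
  apply/negP/prodf_neq0 => l nel; rewrite hornerXsubC subr_eq0 nth_uniq //.
  by rewrite eq_sym.
have Jp : J (d ^+ N * inXi p).
  have -> : inXi p = \sum_j (a j)%:MP * inXi (P j).
    rewrite /inXi rmorph_sum horner_sum; apply: eq_bigr => j _ /=.
    by rewrite map_polyZ hornerZ.
  have -> : d ^+ N * \sum_j (a j)%:MP * inXi (P j) =
      \sum_j (a j)%:MP * inXi (P j) *
         (d ^+ N - (Nu cs`_j).2 * ('X_i - (cs`_j)%:MP)).
    (* Each [P j] times its missing factor is the full product, which therefore comes out in front
       of the dependence relation. *)
    have e0 : \sum_j (a j)%:MP * inXi (P j) *
         ((Nu cs`_j).2 * ('X_i - (cs`_j)%:MP)) = 0.
      rewrite -[RHS](mulr0 (inXi (\prod_(l < D) ('X - (cs`_l)%:P)))).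
      rewrite -[in RHS]a_dep mulr_sumr.
      apply: eq_bigr => j _; rewrite (bigD1 j) //= -/(P j) inXiM inXi_lin.
      by rewrite -mul_mpolyC; ring.
    under [RHS]eq_bigr => j _ do rewrite mulrBr.
    rewrite sumrB e0 subr0 mulr_sumr; apply: eq_bigr => j _; ring.
  apply: ideal_sum => // j; apply: ideal_mull => //.
  by have := NuP cs`_j; case: (cs_fib j) => ->.
(* Modulo [J] a multiple of ['X_i - r] is a power of [d], so each linear factor can be traded for
   such a power. *)
have remove q rs : J (q * inXi (\prod_(r <- rs) ('X - r%:P))) ->
    exists N', J (q * d ^+ N').
  elim: rs q => [|r rs IH] q.
    rewrite big_nil /inXi rmorph1 hornerC mulr1 => Jq.
    by exists 0%N; rewrite mulr1.
  rewrite big_cons inXiM mulrA => /IH[N' JN']; exists ((Nu r).1 + N')%N.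
  have -> : q * d ^+ ((Nu r).1 + N') =
     q * d ^+ N' * (d ^+ (Nu r).1 - (Nu r).2 * ('X_i - r%:MP))
     + (Nu r).2 * (q * inXi ('X - r%:P) * d ^+ N').
    by rewrite inXi_lin exprD; ring.
  by apply: ideal_add => //; apply: ideal_mull.
have [rs def_p] := closed_field_poly_normal p.
have [|N' JN'] := remove (d ^+ N) rs.
  have -> : d ^+ N * inXi (\prod_(r <- rs) ('X - r%:P)) =
     ((lead_coef p)^-1)%:MP * (d ^+ N * inXi p).
    rewrite {2}def_p -mul_polyC inXiM {2}/inXi map_polyC hornerC /=.
    rewrite mulrCA [_%:MP * (_%:MP * _)]mulrA -mpolyCM mulVf ?lead_coef_eq0 //.
    by rewrite mpolyC1 mul1r.
  exact: ideal_mull.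
by apply: (Jd (N + N')%N); rewrite exprD.
Qed.

(** The elements ['X_i - v i] are adjoined one at a time while all powers of [d] stay outside.
    Modulo the resulting ideal each polynomial equals its value at [v]; the ideal is proper, so [J]
    vanishes at [v], and [d] is not in it, so [d] does not vanish there. *)
Lemma exists_point J d : is_ideal J -> (forall N, ~ J (d ^+ N)) ->
  exists2 v : 'I_n -> K, (forall p, J p -> p.@[v] = 0) & d.@[v] != 0.
Proof.
move=> idJ Jd.
have [v [J' [idJ' sJ J'd J'v]]] : exists (v : 'I_n -> K) J',
   [/\ is_ideal J', forall p, J p -> J' p, forall N, ~ J' (d ^+ N) &
    forall i, i \in enum 'I_n -> J' ('X_i - (v i)%:MP)].
  elim: (enum 'I_n) => [|i s [v [J' [idJ' sJ J'd J'v]]]].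
    by exists (fun=> 0), J.
  have [is_|is_] := boolP (i \in s).
    by exists v, J'; split => // j; rewrite inE => /predU1P[->|]; apply: J'v.
  have [c J'c] := exists_coordinate i idJ' J'd.
  exists (fun j => if j == i then c else v j), (adjoin J' ('X_i - c%:MP));
    split => //.
  - exact: adjoinP.
  - by move=> p /sJ; apply: adjoin_sub.
  - move=> j; rewrite inE; case: eqP => [-> _|_ /J'v]; first exact: adjoin_mem.
    exact: adjoin_sub.
have J'ev p : J' (p - p.@[v]%:MP).
  elim/mpolyind: p => [|c m p _ _ IH].
    by rewrite meval0 mpolyC0 subrr; case: idJ'.
  rewrite mevalD mpolyCD opprD addrACA; apply: ideal_add => //.
  rewrite mevalZ mpolyCM -mul_mpolyC -mulrBr; apply: ideal_mull => //.
  rewrite mevalX mpolyXE_id rmorph_prod /=.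
  elim/big_rec2: _ => [|j x y _ Jxy]; first by rewrite subrr; case: idJ'.
  have Je k : J' ('X_j ^+ k - (v j ^+ k)%:MP).
    elim: k => [|k IHk]; first by rewrite !expr0 subrr; case: idJ'.
    have -> : 'X_j ^+ k.+1 - (v j ^+ k.+1)%:MP =
      'X_j * ('X_j ^+ k - (v j ^+ k)%:MP) + (v j ^+ k)%:MP * ('X_j - (v j)%:MP).
      by rewrite !exprS mpolyCM; ring.
    by apply: ideal_add => //; apply: ideal_mull => //; apply: J'v;
      rewrite mem_enum.
  have -> : 'X_j ^+ m j * y - (v j ^+ m j)%:MP * x =
     'X_j ^+ m j * (y - x) + x * ('X_j ^+ m j - (v j ^+ m j)%:MP) by ring.
  by apply: ideal_add => //; apply: ideal_mull.
exists v => [p Jp|].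
  apply/eqP/negPn/negP => nz_pv; apply: (J'd 0%N); rewrite expr0.
  have -> : 1 = (p.@[v]^-1)%:MP * (p - (p - p.@[v]%:MP)) :> {mpoly K[n]}.
    by rewrite opprB addrCA subrr addr0 -mpolyCM mulVf.
  by apply: ideal_mull => //; apply: ideal_sub => //; apply: sJ.
apply/eqP => dv; apply: (J'd 1%N); rewrite expr1.
by have := J'ev d; rewrite dv mpolyC0 subr0.
Qed.

Theorem nullstellensatz (I : finType) (F : I -> {mpoly K[n]}) d :
  (forall v : 'I_n -> K, (forall k, (F k).@[v] = 0) -> d.@[v] = 0) ->
  exists N, ideal_gen F (d ^+ N).
Proof.
move=> Fd; apply: contrapT => /forallNP Nd.
have [v Fv /eqP[]] := exists_point (ideal_genP F) Nd.
by apply: Fd => k; apply: Fv; apply: ideal_gen_mem.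
Qed.

Lemma mpoly_eq0 p : (forall v : 'I_n -> K, p.@[v] = 0) -> p = 0.
Proof.
(* The empty family generates the zero ideal, so a power of [p] is zero. *)
move=> p0; have [N [c]] := @nullstellensatz void (fun=> 0) p (fun v _ => p0 v).
by rewrite big1 => [/eqP|[]//]; rewrite expf_eq0 => /andP[_ /eqP].
Qed.
End Nullstellensatz.

(** * Hypersurfaces containing a smooth curve *)

(** After division by the gcd [h], the cofactor [p1] is coprime to [q1], so all its powers divide
    the fixed polynomial [h ^+ N]; hence [p1] is constant. *)
Lemma dvdp_of_exp (K : fieldType) (p q : {poly K}) N : p != 0 ->
  (forall k, p ^+ k.+1 %| q ^+ (N + k)) -> p %| q.
Proof.
move=> nz_p pq; set h := gcdp p q.
have [p1 def_p] : exists p1, p = p1 * h.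
  by have /dvdpP := dvdp_gcdl p q.
have [q1 def_q] : exists q1, q = q1 * h.
  by have /dvdpP := dvdp_gcdr p q.
have nz_h : h != 0 by rewrite gcdp_eq0 negb_and nz_p.
have cop : coprimep p1 q1.
  have := coprimep_div_gcd (p := p) (q := q); rewrite nz_p => /(_ isT).
  rewrite -/h; have -> : p %/ h = p1 by rewrite def_p mulpK.
  by have -> : q %/ h = q1 by rewrite def_q mulpK.
have p1h k : p1 ^+ k.+1 %| h ^+ N.
  have : p1 ^+ k.+1 * h ^+ k.+1 %| (q1 ^+ (N + k) * h ^+ N) * h ^+ k.+1.
    rewrite -exprMn -def_p; apply: dvdp_trans (pq k) _.
    rewrite {1}def_q exprMn -mulrA dvdp_mul // -exprD dvdp_exp2l //.
    by rewrite leq_add2l.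
  rewrite dvdp_mul2r ?expf_neq0 // Gauss_dvdpr //.
  by rewrite coprimep_expl // coprimep_expr.
have /eqP p1c : size p1 == 1%N.
  have nz_p1 : p1 != 0 by apply: contraNneq nz_p => p10;
    rewrite def_p p10 mul0r.
  rewrite eqn_leq size_poly_gt0 nz_p1 andbT leqNgt; apply/negP => sp1.
  have := dvdp_leq (expf_neq0 N nz_h) (p1h (size (h ^+ N))).
  set m := size (h ^+ N); rewrite leqNgt => /negP[].
  have sp1' : (0 < (size p1).-1)%N by rewrite -ltnS (ltn_predK sp1).
  have : ((size (p1 ^+ m.+1)).-1 < size (p1 ^+ m.+1))%N.
    by rewrite prednK // size_poly_gt0 expf_neq0.
  by apply: leq_trans; rewrite ltnS size_exp (leq_trans (leqnSn m)) //
    leq_pmull.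
have [c nz_c p1E] : exists2 c, c != 0 & p1 = c%:P by apply/size_poly1P/eqP.
by rewrite def_p p1E mul_polyC dvdpZl // def_q dvdp_mull.
Qed.

(** * Restriction of forms to a line *)

Section Line.
Variables (K : fieldType) (n : nat) (a b : 'I_n -> K).
Implicit Types p q : {mpoly K[n]}.

Local Notation line i := ((a i)%:P + b i *: 'X).

Definition on_line : {mpoly K[n]} -> {poly K} :=
  mmap (@polyC K) (fun i => line i).

Lemma on_lineM : {morph on_line : p q / p * q}.
Proof. by move=> p q; rewrite /on_line rmorphM. Qed.

Lemma on_lineX p k : on_line (p ^+ k) = on_line p ^+ k.
Proof. by rewrite /on_line rmorphXn. Qed.

Lemma horner_on_line p : (on_line p).[0] = p.@[a].
Proof.
rewrite /on_line mevalE horner_sum; apply: eq_bigr => m _.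
rewrite hornerM hornerC horner_prod; congr (_ * _); apply: eq_bigr => i _.
by rewrite horner_exp hornerD hornerC hornerZ hornerX mulr0 addr0.
Qed.

(** The degree [d] is nominal: [c] may be zero. *)
Definition top_coef d c (r : {poly K}) := (size r <= d.+1)%N /\ r`_d = c.

Lemma top_coefM d e x y r s : top_coef d x r -> top_coef e y s ->
  top_coef (d + e) (x * y) (r * s).
Proof.
move=> [sr rd] [ss se]; split.
  apply: leq_trans (size_polyMleq r s) _.
  by rewrite -subn1 leq_subLR add1n -addnS -addSn leq_add.
rewrite coefM (bigD1 (inord d)) //= inordK ?ltnS ?leq_addr // addKn rd se.
rewrite big1 ?addr0 // => j /eqP nej.
have [ltj|ltj|/esym eqj] := ltngtP (j : nat) d.
- rewrite [s`__]nth_default ?mulr0 // (leq_trans ss) //.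
  by rewrite ltn_subRL ltn_add2r.
- by rewrite nth_default ?mul0r // (leq_trans sr).
- by case: nej; apply/val_inj; rewrite /= inordK ?ltnS ?leq_addr.
Qed.

Lemma top_coef_on_line d p : p \is d.-homog -> top_coef d p.@[b] (on_line p).
Proof.
move=> /dhomogP homp; rewrite mevalE /on_line /mmap big_seq [X in top_coef _
  _ X]big_seq.
elim/big_rec2: _ => [|m r c pm [sr rd]]; first by split;
  rewrite ?size_poly0 ?coef0.
suff [sm md] : top_coef d (\prod_i b i ^+ m i) (mmap1 (fun i => line i) m).
  rewrite mul_polyC; split; last by rewrite coefD coefZ md rd.
  by rewrite (leq_trans (size_polyD _ _)) // geq_max sr (leq_trans
    (size_scale_leq _ _)).
have -> : d = (\sum_i m i)%N by rewrite -mdegE; apply/esym/homp.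
rewrite /mmap1; elim/big_rec3: _ => [|i r1 k c1 _]; first by split;
  rewrite ?size_poly1 ?coef1.
apply: top_coefM; elim: (m i) => [|e IH]; first by split;
  rewrite ?size_poly1 ?coef1.
rewrite !exprS -add1n; apply: top_coefM => //; split.
  rewrite (leq_trans (size_polyD _ _)) // geq_max size_polyC.
  by rewrite (leq_trans (leq_b1 _)) // (leq_trans (size_scale_leq _ _))
    ?size_polyX.
by rewrite coefD coefC coefZ coefX /= add0r mulr1.
Qed.
End Line.

(** The Leibniz computation of [exp_step], with [fk] for [f ^+ k] and [n] for [k.+1]; the common
    factor [fk] is cancelled there. *)
Lemma derivative_identity (R : comNzRingType) (f fk g D df dg dD : R) m n :
  f * fk * g * dD *+ m = D * (fk * df *+ n * g + f * fk * dg) ->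
  fk * (df * (g * D) *+ n) = fk * (f * (g * dD *+ m - D * dg)).
Proof.
move=> e.
transitivity (D * (fk * df *+ n * g + f * fk * dg) - f * fk * D * dg).
  by ring.
by rewrite -e; ring.
Qed.

Section Proportional.
Variable K : closedFieldType.
Hypotheses (K_uncountable : ~ countable [set: K]).
Hypothesis (K_char0 : forall m, (m.+1%:R : K) != 0).
Variables (f D : {mpoly K[3]}) (d : nat).
Hypotheses (nz_f : f != 0) (homf : f \is d.-homog) (homD : D \is d.-homog).
Hypothesis smooth_f : forall i,
  exists N, ideal_gen (fun l => mderiv l f) ('X_i ^+ N).
Hypothesis fD0 : forall v : 'I_3 -> K, f.@[v] = 0 -> D.@[v] = 0.

(* Differentiating D ^ m = f ^ k.+1 * g shows that every partial derivative of f
   maps g * D into (f); as f is smooth, g * D is in (f). *)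
Let exp_step m k g : D ^+ m = f ^+ k.+1 * g ->
  exists g', D ^+ m.+1 = f ^+ k.+2 * g'.
Proof.
move=> eDf.
have dfgD l : mult_of f (mderiv l f * (g * D)).
  (* The factor [D] avoids the exponent [m - 1], so that [m = 0] fits the same formula. *)
  have e : D * mderiv l (D ^+ m) = D * mderiv l (f ^+ k.+1 * g) by rewrite eDf.
  have eD : D * mderiv l (D ^+ m) = (f ^+ k.+1 * g * mderiv l D) *+ m.
    case: (m) eDf => [|m'] eDf; last by rewrite mderiv_exp -eDf exprS; ring.
    by rewrite expr0 -mpolyC1 mderivC mulr0 mulr0n.
  move: e; rewrite eD mderivM mderiv_exp => e.
  have {}e : (k.+1%:R : K) *: (mderiv l f * (g * D)) =
      f * (g * mderiv l D *+ m - D * mderiv l g).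
    apply: (mulfI (expf_neq0 k nz_f)); rewrite scaler_nat.
    by apply: derivative_identity; rewrite -exprS.
  exists ((k.+1%:R : K)^-1 *: (g * mderiv l D *+ m - D * mderiv l g)).
  by rewrite -scalerAr -e scalerA mulVf // scale1r.
have [g' gE] : mult_of f (g * D).
  have XgD i : exists N, mult_of f ('X_i ^+ N * (g * D)).
    have [N [c XN]] := smooth_f i; exists N; rewrite XN mulr_suml.
    apply: (ideal_sum (mult_ofP f)) => l; rewrite -mulrA.
    exact: (ideal_mull (mult_ofP f)).
  have [[N0 X0] [N1 X1]] := (XgD 0, XgD 1).
  exact: (saturated (isT : 0 != 1 :> 'I_3) nz_f X0 X1).
by exists g'; rewrite exprSr eDf -mulrA gE mulrA -exprSr.
Qed.

(** The Nullstellensatz starts, and [exp_step] continues, a sequence of divisibilities of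
    [D ^+ (N + k)] by [f ^+ k.+1]. On a line with direction [b], where f(b) is nonzero,
    [dvdp_of_exp] makes the restriction of [f] divide that of [D]. *)
Theorem proportional_of_smooth : exists c : K, D = c *: f.
Proof.
have [N [c DN]] : exists N, ideal_gen (fun _ : unit => f) (D ^+ N).
  by apply: nullstellensatz => // v /(_ tt)/fD0.
rewrite (bigD1 tt) //= big1 ?addr0 in DN; last by case.
have pows k : exists g, D ^+ (N + k) = f ^+ k.+1 * g.
  elim: k => [|k [g IH]]; first by exists (c tt); rewrite addn0 DN expr1 mulrC.
  by rewrite addnS; apply: exp_step IH.
have [b fb] : exists b, f.@[b] != 0.
  apply: contrapT => /forallNP f0; case/eqP: nz_f; apply: mpoly_eq0 => // v.
  by apply/eqP/negPn/negP/f0.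
have prop a : D.@[a] * f.@[b] = D.@[b] * f.@[a].
  pose F := on_line a b f; pose G := on_line a b D.
  have [sF Fd] := top_coef_on_line a b homf;
    have [sG Gd] := top_coef_on_line a b homD.
  have nzF : F != 0 by apply: contraNneq fb => F0; rewrite -Fd -/F F0 coef0.
  have /dvdpP[h GE] : F %| G.
    apply: (@dvdp_of_exp _ _ _ N) => // k;
      have [g /(congr1 (on_line a b))] := pows k.
    by rewrite on_lineM !on_lineX -/F -/G => ->; apply: dvdp_mulr.
  (* The coefficient of degree [d] of [F] is f(b), so [F] has full degree and the quotient is
     constant; comparing the values at 0 and the top coefficients yields the proportion. *)
  have sFd : size F = d.+1.
    apply/eqP; rewrite eqn_leq sF ltnNge; apply/negP => sFd.
    by case/eqP: fb; rewrite -Fd nth_default.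
  have [c0 hc] : exists c0, h = c0%:P.
    exists h`_0; apply: size1_polyC; have [->|nzh] := eqVneq h 0;
      first by rewrite size_poly0.
    by move: sG; rewrite -/G GE size_mul // sFd addnS /= -add1n leq_add2r.
  have [Da fa] := (horner_on_line a b D, horner_on_line a b f).
  rewrite -Da -fa -Fd -Gd -/F -/G GE hc hornerM hornerC coefCM.
  by rewrite mulrAC.
exists (D.@[b] / f.@[b]); apply/eqP; rewrite -subr_eq0; apply/eqP.
apply: mpoly_eq0 => // a; rewrite mevalB mevalZ mulrAC -prop mulfK //.
by rewrite subrr.
Qed.
End Proportional.

(** * Unramified quadratic systems *)

Section QuadraticFibre.
Variables (K : closedFieldType) (N m : nat).
(** [p *m L q] is a symmetric bilinear map B(p, q). Negligible vectors lie in its kernel and, at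
    each solution, exhaust the kernel of the differential; solutions are counted modulo them. *)
Variable L : {linear 'rV[K]_N -> 'M[K]_(N, m)}.
Variables (f : 'rV[K]_m) (negligible : 'rV[K]_N -> Prop).
Hypothesis nz2 : (2%:R : K) != 0.
Hypothesis L_sym : forall p q, p *m L q = q *m L p.
Hypothesis negligible_ker : forall u, negligible u -> forall q, u *m L q = 0.
Hypothesis ker_negligible :
  forall p u, p *m L p = f -> u *m L p = 0 -> negligible u.

Lemma msize_prod_leq (n r : nat) (F : 'I_r -> {mpoly K[n]}) e :
  (forall i, msize (F i) <= e)%N -> (msize (\prod_i F i) <= (r * e.+1).+1)%N.
Proof.
elim: r F => [|r IH] F leF; first by rewrite big_ord0 msize1.
rewrite big_ord_recl (leq_trans (msizeM_le _ _)) // mulSn addSn -!addnS.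
by rewrite leq_add ?ltnS ?IH.
Qed.

Lemma msize_det_leq (n r : nat) (A : 'M[{mpoly K[n]}]_r) e :
  (forall i j, msize (A i j) <= e)%N -> (msize (\det A) <= (r * e.+1).+1)%N.
Proof.
move=> leA; apply: (leq_trans (msize_sum _ _ _)).
apply/bigmax_leqP => s _; rewrite mulr_sign.
by case: ifP => _; rewrite ?msizeN; apply: msize_prod_leq => i.
Qed.

(* As p *m L p is constant on the fibre, (p - q) *m L (p + q) = 0: a minor of
   L (p + q) that does not vanish at q = p vanishes at all other points q. *)
Lemma separating_poly p : p *m L p = f -> exists F : {mpoly K[N]},
  [/\ (msize F <= (N * 3).+1)%N, F.@[p 0] != 0 &
   forall q, q *m L q = f -> ~ negligible (p - q) -> F.@[q 0] = 0].
Proof.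
move=> pf; set r := \rank (L p).
(* One-sided inverses of the factors of a rank decomposition: det(A L(p + q) C) is a generalised
   minor, and equals [2 ^ r] at [q = p]. *)
have [A [C AC]] : exists (A : 'M_(r, N)) (C : 'M_(m, r)), A *m L p *m C = 1%:M.
  have [A eA] : exists A, A *m col_base (L p) = 1%:M.
    by exists (pinvmx (col_base (L p))); rewrite mulVpmx ?col_base_full.
  have [C eC] : exists C, row_base (L p) *m C = 1%:M.
    by exists (pinvmx (row_base (L p))); rewrite mulmxVp ?row_base_free.
  exists A, C; rewrite -[X in _ *m X *m _](mulmx_base (L p)).
  by rewrite mulmxA eA mul1mx eC.
pose M : 'M[{mpoly K[N]}]_(N, m) :=
  \matrix_(i, j) ((L p i j)%:MP + \sum_k (L (delta_mx 0 k) i j) *: 'X_k).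
pose G := map_mx (@mpolyC N K) A *m M *m map_mx (@mpolyC N K) C.
have M_ev (q : 'rV[K]_N) : map_mx (meval (q 0)) M = L (p + q).
  apply/matrixP => i j; rewrite !mxE mevalD mevalC linearD mxE; congr (_ + _).
  have -> : L q = \sum_k q 0 k *: L (delta_mx 0 k).
    rewrite {1}(row_sum_delta q) linear_sum.
    by apply: eq_bigr => k _; rewrite linearZ.
  rewrite summxE raddf_sum; apply: eq_bigr => k _ /=.
  by rewrite mevalZ mevalXU mxE mulrC.
have G_ev (q : 'rV[K]_N) : (\det G).@[q 0] = \det (A *m L (p + q) *m C).
  rewrite -det_map_mx; congr (\det _); rewrite !map_mxM /= M_ev.
  by congr (_ *m _ *m _); apply/matrixP => i j; rewrite !mxE mevalC.
have M_lin i j : (msize (M i j) <= 2)%N.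
  rewrite mxE (leq_trans (msizeD_le _ _)) // geq_max; apply/andP; split.
    by rewrite msizeC; case: eqP.
  rewrite (leq_trans (msize_sum _ _ _)) //; apply/bigmax_leqP => k _.
  by rewrite (leq_trans (msizeZ_le _ _)) // msizeX mdeg1.
exists (\det G); split.
- have leG i j : (msize (G i j) <= 2)%N.
    rewrite mxE (leq_trans (msize_sum _ _ _)) //; apply/bigmax_leqP => k _.
    rewrite [map_mx _ C k j]mxE mulrC mul_mpolyC (leq_trans (msizeZ_le _ _)) //.
    rewrite mxE (leq_trans (msize_sum _ _ _)) //; apply/bigmax_leqP => l _.
    by rewrite [map_mx _ A i l]mxE mul_mpolyC (leq_trans (msizeZ_le _ _)).
  by rewrite (leq_trans (msize_det_leq leG)) // ltnS leq_mul // rank_leq_row.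
- rewrite G_ev -[p + p]mulr2n -scaler_nat linearZ /= -scalemxAr -scalemxAl.
  by rewrite AC detZ det1 mulr1 expf_neq0.
- move=> q qf pq; rewrite G_ev; apply/eqP/negPn/negP => det_neq0.
  have rkr : (r <= \rank (L (p + q)%R))%N.
    have : A *m L (p + q) *m C \in unitmx by rewrite unitmxE unitfE.
    rewrite -row_free_unit /row_free => /eqP {1}<-.
    exact: leq_trans (mxrankM_maxl _ _) (mxrankM_maxr _ _).
  (* The kernel of [L p] is negligible, so [L (p + q)] kills it too; it also kills [p - q], which is
     not negligible. Its rank is thus less than [r]. *)
  have : (kermx (L p) < kermx (L (p + q)%R))%MS.
    rewrite ltmxE; apply/andP; split.
      apply/row_subP => i; apply/sub_kermxP.
      apply: negligible_ker; apply: (ker_negligible pf).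
      by apply/sub_kermxP/row_sub.
    apply/negP => sub; apply: pq; apply: (ker_negligible pf).
    apply/sub_kermxP; apply: submx_trans sub; apply/sub_kermxP.
    by rewrite linearD /= mulmxBl !mulmxDr (L_sym q p) pf qf [X in _ -
      X]addrC subrr.
  move/rank_ltmx; rewrite !mxrank_ker ltnNge => /negP[].
  exact: leq_sub2l.
Qed.

(** Each separating polynomial is nonzero at its own solution and zero at the others, so pairwise
    distinct solutions modulo negligible vectors are at most as many as the monomials of degree at
    most [3 N]. *)
Theorem quadratic_fibre_finite : exists B : nat, forall ps : 'I_B -> 'rV[K]_N,
  (forall j, ps j *m L (ps j) = f) ->
  exists i j, i != j /\ negligible (ps i - ps j).
Proof.
exists #|{: 'X_{1..N < (N * 3).+1}}|.+1 => ps ps_f.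
apply: contrapT => nex.
have /choice[F FP] := fun j => separating_poly (ps_f j).
have [||a a_dep [j0 nz_a]] := @mpoly_dependence K N (N * 3).+1 _ F.
- exact: ltnSn.
- by move=> j; case: (FP j).
case/eqP: nz_a; have := congr1 (meval (ps j0 0)) a_dep.
rewrite meval0 raddf_sum (bigD1 j0) //= big1 => [|j nej].
  rewrite addr0 mevalZ => /eqP; rewrite mulf_eq0.
  by case: (FP j0) => _ /negbTE-> _; rewrite orbF => /eqP.
rewrite mevalZ; case: (FP j) => _ _ -> //; first by rewrite mulr0.
by move=> neg; apply: nex; exists j, j0.
Qed.
End QuadraticFibre.

(** * Biquadratic forms *)

Section BdiscTheory.
Variables (R R' : comNzRingType) (phi : {rmorphism R -> R'}).
Implicit Types (x : 'I_3 -> R) (S T : 'M[R]_3).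

Lemma bdiscC x S T : bdisc x S T = bdisc x T S.
Proof. by apply: eq_bigr => i _; apply: eq_bigr => j _; ring. Qed.

Lemma bdiscZr x k S T : bdisc x S (k *: T) = k * bdisc x S T.
Proof.
rewrite /bdisc mulr_sumr; apply: eq_bigr => i _; rewrite mulr_sumr.
by apply: eq_bigr => j _; rewrite !mxE; ring.
Qed.

Lemma bdiscDr x S T T' : bdisc x S (T + T') = bdisc x S T + bdisc x S T'.
Proof.
rewrite /bdisc -big_split; apply: eq_bigr => i _; rewrite -big_split.
by apply: eq_bigr => j _; rewrite !mxE /=; ring.
Qed.

Lemma rmorph_bdisc x S T :
  phi (bdisc x S T) = bdisc (phi \o x) (map_mx phi S) (map_mx phi T).
Proof.
rewrite /bdisc rmorph_sum; apply: eq_bigr => i _; rewrite rmorph_sum.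
apply: eq_bigr => j _; rewrite !mxE /=.
by rewrite !(rmorphM, rmorphB, rmorphD) /=.
Qed.

Lemma map_crossmx x : map_mx phi (crossmx x) = crossmx (phi \o x).
Proof.
apply/matrixP => i j; rewrite !mxE; case: ifP => _; first exact: rmorph0.
by case: ifP => _ //=; rewrite rmorphN.
Qed.

Lemma map_sandwich x S :
  map_mx phi (sandwich x S) = sandwich (phi \o x) (map_mx phi S).
Proof. by rewrite /sandwich !map_mxM map_crossmx. Qed.
End BdiscTheory.

(** Both terms of the anticommutator contain the factor [[x] S [x]], so the product of [bdisc x S T]
    with [[x]] is zero; its entry (0, 1) is read off. *)
Lemma bdisc_sandwich0 (R : idomainType) (x : 'I_3 -> R) (S T : 'M[R]_3) :
  x 2%:R != 0 -> S^T = S -> T^T = T -> sandwich x S = 0 -> bdisc x S T = 0.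
Proof.
move=> nzx sS sT S0; have := sandwich_anticomm x sS sT.
have -> : sandwich x T *m S *m crossmx x = crossmx x *m T *m sandwich x S.
  by rewrite /sandwich !mulmxA.
rewrite S0 !mul0mx mulmx0 addr0 => /matrixP/(_ 0 1)/eqP.
rewrite [X in X == _]mxE [X in _ == X]mxE crossmxE eq_sym mulf_eq0.
by rewrite !oppr_eq0 (negbTE nzx) orbF => /eqP.
Qed.

(** If [f = 'X_2 g], then on ['X_2 = 0] all partials are multiples of [g], so smoothness makes [g] a
    unit there. The constant term of [g] is also that of the derivative along ['X_2], a form of
    positive degree: a contradiction. *)
Lemma kill_var_neq0 (K : fieldType) (f : {mpoly K[3]}) d :
  f \is d.+2.-homog ->
  (forall i, exists N, ideal_gen (fun l => mderiv l f) ('X_i ^+ N)) ->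
  comp_mpoly (kill_tuple K 2%:R) f != 0.
Proof.
move=> homf smooth_f; apply/eqP => /kill_var_eq0[g def_f].
pose tau : {rmorphism {mpoly K[3]} -> {mpoly K[3]}} :=
  comp_mpoly (kill_tuple K (2%:R : 'I_3)).
have tauX i : tau 'X_i = if i == 2%:R then 0 else 'X_i := kill_varX K 2%:R i.
have df l : mderiv l f = (l == 2%:R)%:R * g + 'X_2%:R * mderiv l g.
  by rewrite def_f mderivM mderivXU.
have Xg i : i != 2%:R -> exists N, mult_of (tau g) ('X_i ^+ N * 1).
  move=> i2; have [N [c /(congr1 tau) XN]] := smooth_f i; exists N;
    rewrite mulr1.
  move: XN; rewrite rmorphXn /= tauX (negbTE i2) => ->.
  rewrite rmorph_sum; apply: (ideal_sum (mult_ofP _)) => l /=.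
  rewrite rmorphM /= df rmorphD !rmorphM /= tauX eqxx mul0r addr0.
  rewrite rmorph_nat mulrCA; apply: (ideal_mull (mult_ofP _)); rewrite mulrC.
  by eexists; reflexivity.
have nz_g : tau g != 0.
  have [N [h /eqP]] := Xg 0 isT; rewrite mulr1; apply: contraTneq => ->.
  by rewrite mul0r expf_eq0 (negbTE (mpolyX_neq0 _ _)) andbF.
have [[N0 X0] [N1 X1]] := (Xg 0 isT, Xg 1 isT).
have [w /(congr1 (mcoeff 0))] := saturated (isT : 0 != 1 :> 'I_3) nz_g X0 X1.
rewrite rmorphM /= mcoeff1 eqxx /= => w1.
have [h /(congr1 (mcoeff 0))] := kill_var_mod 2%:R g.
rewrite rmorphM mcoeffB /= mcoeffX (_ : _ == _ = false) ?mul0r; last first.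
  by rewrite mnm1_eq0.
move/eqP; rewrite subr_eq0 => /eqP g0.
have := congr1 (mcoeff 0) (df 2%:R).
rewrite eqxx mul1r mcoeffD rmorphM /= mcoeffX mnm1_eq0 mul0r addr0.
have df0 : (mderiv 2%:R f)@_0 = 0.
  have e : mdeg (0%MM : 'X_{1..3}) != d.+1 by rewrite mdeg0.
  exact: dhomog_nemf_coeff (mderiv_homog _ homf) e.
by rewrite df0 => gz; move/eqP: w1; rewrite -g0 -gz mul0r oner_eq0.
Qed.

Section Biquadratic.
Variable K : fieldType.
Local Notation P := {mpoly K[3]}.
Local Notation X := (fun i : 'I_3 => 'X_i : P).
Local Notation index := ('I_3 * 'I_3 * ('I_3 * 'I_3))%type.
(* Codings of the coefficient indices and of the sextic monomials, kept abstract
   so that no cardinal is ever computed. *)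
Variables (N M : nat) (rk : index -> 'I_N) (mon : 'I_M -> 'X_{1..3}).
Hypothesis monP : forall m, mdeg m = 6%N -> exists j, mon j = m.
Implicit Types c u : 'rV[K]_N.

Definition bicoef c i j k l : K := c 0 (rk ((i, j), (k, l))).

Definition biform c (x z : 'rV[K]_3) : K :=
  \sum_k \sum_l (\sum_i \sum_j bicoef c i j k l * (x 0 i * x 0 j)) * (z 0 k *
    z 0 l).

(** Symmetrised in [k, l] without halving: its quadratic form in z is twice [biform c]. *)
Definition gram c : 'M[P]_3 :=
  \matrix_(k, l) \sum_i \sum_j (bicoef c i j k l +
    bicoef c i j l k) *: ('X_i * 'X_j).

Lemma gram_sym c : (gram c)^T = gram c.
Proof.
apply/matrixP => k l; rewrite !mxE; apply: eq_bigr => i _;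
  apply: eq_bigr => j _.
by rewrite addrC.
Qed.

Lemma gramP a c u : gram (a *: c + u) = a%:MP *: gram c + gram u.
Proof.
apply/matrixP => k l; rewrite !mxE mulr_sumr -big_split.
apply: eq_bigr => i _ /=; rewrite mulr_sumr -big_split;
  apply: eq_bigr => j _ /=.
by rewrite /bicoef !mxE -!mul_mpolyC !mpolyCD !mpolyCM; ring.
Qed.

Lemma gram_homog c i j : gram c i j \is 2.-homog.
Proof.
rewrite mxE; do 2!(apply: rpred_sum => ? _); apply: rpredZ.
by rewrite -[2%N]/(1 + 1)%N dhomogM ?dhomogX /= ?mdeg1.
Qed.

Definition discriminant c u : P := bdisc X (gram c) (gram u).

Lemma discriminant_homog c u : discriminant c u \is 6.-homog.
Proof.
have hM d e (p q : P) : p \is d.-homog -> q \is e.-homog -> p * q \is (d +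
  e).-homog.
  exact: dhomogM.
have hX i : X i \is [in K[3], 1.-homog] by rewrite dhomogX /= mdeg1.
do 2!(apply: rpred_sum => ? _).
apply: (hM 2 4)%N; first exact: (hM 1 1)%N.
by do !apply: rpredB || apply: rpredD; apply: (hM 2 2)%N; apply: gram_homog.
Qed.

Lemma discriminantP c a u v :
  discriminant c (a *: u + v) = a *: discriminant c u + discriminant c v.
Proof. by rewrite /discriminant gramP bdiscDr bdiscZr mul_mpolyC. Qed.

Lemma discriminantC c u : discriminant c u = discriminant u c.
Proof. exact: bdiscC. Qed.

Lemma discriminant_sum c u :
  discriminant u c = \sum_i u 0 i *: discriminant (delta_mx 0 i) c.
Proof.
rewrite {1}(row_sum_delta u) discriminantC.
elim/big_rec2: _ => [|i y1 y2 _ IH];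
  last by rewrite discriminantP IH discriminantC.
have /eqP := discriminantP c 1 0 0; rewrite !scale1r addr0 -subr_eq0 opprD.
by rewrite addNKr oppr_eq0 => /eqP.
Qed.

(* [c *m polar c] lists the coefficients of the sextic [discriminant c c]. *)
Definition polar c : 'M[K]_(N, M) :=
  \matrix_(i, j) (discriminant (delta_mx 0 i) c)@_(mon j).

Lemma polarE c i j : polar c i j =
  (discriminant (delta_mx 0 i) c)@_(mon j).
Proof. exact: mxE. Qed.

Lemma polar_linear : linear polar.
Proof.
move=> a u v; apply/matrixP => i j.
have -> (A B : 'M[K]_(N, M)) : (a *: A + B) i j = a * A i j + B i j.
  by rewrite !mxE.
apply: etrans (polarE _ _ _) _; rewrite discriminantP mcoeffD mcoeffZ.
by congr (_ * _ + _); apply/esym/polarE.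
Qed.

HB.instance Definition _ := GRing.isLinear.Build _ _ _ _ polar polar_linear.

Lemma mul_polar u c : u *m polar c =
  \row_j (discriminant u c)@_(mon j).
Proof.
apply/rowP => j; rewrite mxE [RHS]mxE discriminant_sum raddf_sum.
by apply: eq_bigr => i _ /=; rewrite polarE mcoeffZ.
Qed.

Lemma mul_polarP u c (f : P) : f \is 6.-homog ->
  u *m polar c = \row_j f@_(mon j) <->
  discriminant u c = f.
Proof.
move=> homf; rewrite mul_polar; split=> [e|-> //]; apply/mpolyP => m.
have [m6|m6] := eqVneq (mdeg m) 6%N; last first.
  by rewrite (dhomog_nemf_coeff homf m6) (dhomog_nemf_coeff
    (discriminant_homog u c) m6).
have [j <-] := monP m6; have := congr1 (fun B : 'rV_ _ => B 0 j) e.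
by rewrite !mxE.
Qed.

(* The form [biform u] vanishes on the flag variety. *)
Definition negligible u := sandwich X (gram u) = 0.

Lemma negligible_discriminant u c : negligible u -> discriminant u c = 0.
Proof.
move=> u0; apply: bdisc_sandwich0 (mpolyX_neq0 K _) _ _ u0; exact: gram_sym.
Qed.
End Biquadratic.

Local Open Scope card_scope.

(** * Binary quadratic forms *)

Lemma card_eq_II2 T (A : set T) :
  A #= `I_2 <-> exists a b, a <> b /\ A = [set a; b].
Proof.
split=> [/card_set_bijP[f [fA finj fsurj]]|[a [b [ab ->]]]].
  have [a Aa fa] := fsurj 0%N isT; have [b Ab fb] := fsurj 1%N isT.
  exists a, b; split=> [e|]; first by move: fa; rewrite e fb.
  apply/seteqP; split=> [x Ax|x [->|->]//].
  have fx y : A y -> f x = f y -> x = y.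
    by move=> Ay; exact: finj (mem_set Ax) (mem_set Ay).
  have := fA x Ax.
  case E: (f x) => [|[|//]] _; [left|right]; apply: fx => //.
    by rewrite E fa.
  by rewrite E fb.
apply/card_set_bijP; exists (fun x => if `[< x = a >] then 0%N else 1%N); split.
- by move=> x _; rewrite /=; case: ifP.
- move=> x y /set_mem[->|->] /set_mem[->|->] //.
    by case: asboolP => // _; case: asboolP => // ba _; case: ab.
  by case: asboolP => [ba|_]; [case: ab|case: asboolP].
- case=> [|[|//]] _; first by exists a; [left|case: asboolP].
  by exists b; [right|case: asboolP => // ba; case: ab].
Qed.

Section BinaryForms.
Variables (K : closedFieldType) (vT : vectType K).
Hypothesis nz2 : (2%:R : K) != 0.
Implicit Types (u v : vT).

Lemma vline_eqP u v : u != 0 ->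
  <[u]>%VS = <[v]>%VS <-> exists2 k, k != 0 & v = k *: u.
Proof.
move=> nzu; split=> [e|[k nzk ->]].
  have /vlineP[k def_u] : u \in <[v]>%VS by rewrite -e memv_line.
  have nzk : k != 0 by apply: contraNneq nzu => k0; rewrite def_u k0 scale0r.
  exists k^-1; first by rewrite invr_eq0.
  by rewrite def_u scalerA mulVf ?scale1r.
apply/vspaceP => w; apply/vlineP/vlineP => -[c ->].
  by exists (c / k); rewrite scalerA divfK.
by exists (c * k); rewrite scalerA.
Qed.

(** The quadratic formula, with [d] a square root of [b ^+ 2 - a * c]. *)
Lemma binary_form_factor (a b c : K) : exists p q r s : K,
  [/\ a = p * r, b *+ 2 = p * s + q * r & c = q * s].
Proof.
have [->|nza] := eqVneq a 0.
  by exists 0, 1, (b *+ 2), c; split; ring.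
have [d dE] : exists d, d ^+ 2 = b ^+ 2 - a * c.
  have [d] := solve_monicpoly (fun i =>
    if i == 0%N then b ^+ 2 - a * c else 0) (isT : (0 < 2)%N).
  by rewrite !big_ord_recl big_ord0 /= => dE; exists d; rewrite dE; ring.
exists 1, ((b + d) / a), a, (b - d); split; first by ring.
  by rewrite divfK //; ring.
apply: (mulfI nza); have -> : a * ((b + d) / a * (b - d)) = (b + d) * (b - d).
  by rewrite mulrA [a * _]mulrC divfK.
by transitivity (b ^+ 2 - d ^+ 2); [rewrite dE|]; ring.
Qed.

(** If the discriminant vanishes, two isotropic vectors are orthogonal, so two isotropic lines would
    give a third one, spanned by the sum. Otherwise the form is a product of two independent linear
    forms, each vanishing on one line. *)
Lemma binary_form_lines (u v : vT) (a b c : K) :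
  (forall s t, s *: u + t *: v = 0 -> s = 0 /\ t = 0) ->
  [set <[z]>%VS | z in [set z | z != 0 /\ exists s t,
      z = s *: u + t *: v /\ a * s ^+ 2 + b * s * t *+ 2 + c * t ^+ 2 = 0]]
    #= `I_2 <-> a * c - b ^+ 2 != 0.
Proof.
move=> free_uv; set F := (X in X #= _).
have uniq_uv s t s' t' : s *: u + t *: v = s' *: u + t' *: v -> s = s' /\ t =
  t'.
  move=> e; have [|] := free_uv (s - s') (t - t').
    by rewrite !scalerBl addrACA e -opprD subrr.
  by move=> /eqP; rewrite subr_eq0 => /eqP-> /eqP; rewrite subr_eq0 => /eqP.
split=> [/card_eq_II2[A [B [AB FE]]]|nzD].
  apply/eqP => D0.
  have [z1 [nz1 [s1 [t1 [z1E q1]]]] z1A] : F A by rewrite FE; left.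
  have [z2 [nz2' [s2 [t2 [z2E q2]]]] z2B] : F B by rewrite FE; right.
  have p0 : a * s1 * s2 + b * (s1 * t2 + s2 * t1) + c * t1 * t2 = 0.
    apply/eqP; rewrite -sqrf_eq0; apply/eqP.
    transitivity ((a * s1 ^+ 2 + b * s1 * t1 *+ 2 + c * t1 ^+ 2) *
       (a * s2 ^+ 2 + b * s2 * t2 *+ 2 + c * t2 ^+ 2)
       - (a * c - b ^+ 2) * (s1 * t2 - s2 * t1) ^+ 2); first by ring.
    by rewrite q1 D0 !mul0r subrr.
  have indep k l : k *: z1 = l *: z2 -> k = 0.
    move=> e; apply/eqP/negPn/negP => nzk; apply: AB; rewrite -z1A -z2B.
    have nzl : l != 0.
      by apply: contraNneq nz1 => l0; move/eqP: e;
        rewrite l0 scale0r scaler_eq0 (negbTE nzk).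
    apply/esym/vline_eqP => //; exists (k^-1 * l).
      by rewrite mulf_neq0 ?invr_eq0.
    by rewrite -scalerA -e scalerA mulVf ?scale1r.
  have nz12 : z1 + z2 != 0.
    apply/eqP => e; have /indep/eqP : 1 *: z1 = (-1) *: z2.
      by rewrite scale1r scaleN1r; apply/eqP; rewrite -addr_eq0 e.
    by rewrite oner_eq0.
  have : F <[z1 + z2]>%VS.
    exists (z1 + z2) => //; split=> //; exists (s1 + s2), (t1 + t2); split.
      by rewrite z1E z2E !scalerDl addrACA.
    transitivity ((a * s1 ^+ 2 + b * s1 * t1 *+ 2 + c * t1 ^+ 2) +
       (a * s2 ^+ 2 + b * s2 * t2 *+ 2 + c * t2 ^+ 2)
       + (a * s1 * s2 + b * (s1 * t2 + s2 * t1) + c * t1 * t2) *+ 2);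
           first by ring.
    by rewrite q1 q2 p0 mul0rn !addr0.
  rewrite FE => -[]; rewrite -?z1A -?z2B => /vline_eqP => /(_ nz12)[k nzk e].
    have e' : (1 - k) *: z1 = k *: z2.
      by apply/eqP; rewrite scalerBl scale1r subr_eq addrC -scalerDr -e.
    have /eqP := indep _ _ e'; rewrite subr_eq0 => /eqP k1.
    move: e'; rewrite -k1 subrr scale0r scale1r => z20.
    by rewrite -z20 eqxx in nz2'.
  have e' : k *: z1 = (1 - k) *: z2.
    by apply/eqP; rewrite eq_sym scalerBl scale1r subr_eq -scalerDr -e.
  by rewrite (indep _ _ e') eqxx in nzk.
have [p [q [r [s [aE bE cE]]]]] := binary_form_factor a b c.
have factor x y : a * x ^+ 2 + b * x * y *+ 2 + c * y ^+ 2 =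
  (p * x + q * y) * (r * x + s * y).
  transitivity (a * x ^+ 2 + (b *+ 2) * x * y + c * y ^+ 2); first by ring.
  by rewrite aE bE cE; ring.
(* The square of the determinant of the two linear factors is -4 times [a * c - b ^+ 2]. *)
have nzE : p * s - q * r != 0.
  have : (p * s - q * r) ^+ 2 = - (4%:R * (a * c - b ^+ 2)).
    transitivity ((b *+ 2) ^+ 2 - 4%:R * a * c); last by ring.
    by rewrite bE aE cE; ring.
  move=> e; rewrite -sqrf_eq0 e oppr_eq0 mulf_neq0 //.
  by rewrite (natrM K 2 2) mulf_neq0.
have root_line x y p' q' : (p' != 0) || (q' != 0) -> p' * x + q' * y = 0 ->
    exists k, x *: u + y *: v = k *: (q' *: u - p' *: v).
  move=> nz e; have [p0|nzp] := eqVneq p' 0; last first.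
    have kp : - y / p' * p' = - y by rewrite divfK.
    have kq : - y / p' * q' = x.
      apply: (mulfI nzp); rewrite mulrCA mulrA kp.
      by apply/eqP; rewrite mulNr mulrC eq_sym -addr_eq0 e.
    by exists (- y / p'); rewrite scalerBr !scalerA kp kq scaleNr opprK.
  move: nz e; rewrite p0 eqxx mul0r add0r /= => nzq /eqP.
  rewrite mulf_eq0 (negbTE nzq) => /eqP->.
  by exists (x / q'); rewrite !scale0r subr0 addr0 scalerA divfK.
pose z1 := q *: u - p *: v; pose z2 := s *: u - r *: v.
have nz_line x y : (x != 0) || (y != 0) -> y *: u - x *: v != 0.
  apply: contraL => /eqP; rewrite -scaleNr => /free_uv[-> /eqP].
  by rewrite oppr_eq0 => /eqP->; rewrite eqxx.
have nzpq : (p != 0) || (q != 0).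
  rewrite -negb_and; apply: contra nzE => /andP[/eqP-> /eqP->].
  by rewrite !mul0r subrr.
have nzrs : (r != 0) || (s != 0).
  rewrite -negb_and; apply: contra nzE => /andP[/eqP-> /eqP->].
  by rewrite !mulr0 subrr.
apply/card_eq_II2; exists <[z1]>%VS, <[z2]>%VS; split.
  move=> /vline_eqP => /(_ (nz_line _ _ nzpq))[k _].
  rewrite /z1 /z2 scalerBr !scalerA -!scaleNr => /uniq_uv[sE /oppr_inj rE].
  by case/eqP: nzE; rewrite sE rE; ring.
apply/seteqP; split=> [_ [z [nzz [x [y [zE q0]]]] <-]|_ [->|->]].
- have lineE w k : z = k *: w -> <[z]>%VS = <[w]>%VS.
    move=> e; apply/esym/vline_eqP; last exists k => //.
      by apply: contraNneq nzz => w0; rewrite e w0 scaler0.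
    by apply: contraNneq nzz => k0; rewrite e k0 scale0r.
  move/eqP: q0; rewrite factor mulf_eq0 => /orP[] /eqP /root_line.
    by move=> /(_ nzpq)[k e]; left; apply: (lineE _ k); rewrite zE.
  by move=> /(_ nzrs)[k e]; right; apply: (lineE _ k); rewrite zE.
- exists z1 => //; split; first exact: nz_line.
  by exists q, (- p); rewrite scaleNr; split=> //; rewrite factor; ring.
- exists z2 => //; split; first exact: nz_line.
  by exists s, (- r); rewrite scaleNr; split=> //; rewrite factor; ring.
Qed.
End BinaryForms.

(** * The fibres of the first projection *)

Section Perp.
Variable K : fieldType.
Implicit Types (x z w : 'rV[K]_3) (S : 'M[K]_3).

Definition dot x z : K := \sum_i x 0 i * z 0 i.

Definition bform S z w : K := (z *m S *m w^T) 0 0.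

Lemma bformDl S z z' w : bform S (z + z') w = bform S z w + bform S z' w.
Proof. by rewrite /bform !mulmxDl mxE. Qed.

Lemma bformZl S k z w : bform S (k *: z) w = k * bform S z w.
Proof. by rewrite /bform -!scalemxAl mxE. Qed.

Lemma bformC S z w : S^T = S -> bform S z w = bform S w z.
Proof.
move=> sS; rewrite /bform.
have -> : z *m S *m w^T = (w *m S *m z^T)^T by rewrite !trmx_mul trmxK sS
  mulmxA.
by rewrite mxE.
Qed.

Definition perp_row x (i : 'I_3) : 'rV[K]_3 := row i (crossmx (x 0)).

Lemma perp_rowE x i j : perp_row x i 0 j = crossmx (x 0) i j.
Proof. exact: mxE. Qed.

Lemma comb_rowE k l z w j : (k *: z + l *: w) 0 j = k * z 0 j + l * w 0 j.
Proof. by rewrite !mxE. Qed.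

(** The rows of [[x]] are orthogonal to x, and two of them form a basis of the orthogonal as soon as
    the remaining coordinate of x is nonzero. *)
Lemma perp_span x z (i : 'I_3) : x 0 i != 0 -> dot x z = 0 ->
  z = (- (z 0 (i + 2%:R) / x 0 i)) *: perp_row x (i + 1)
    + (z 0 (i + 1) / x 0 i) *: perp_row x (i + 2%:R).
Proof.
move=> nzi; rewrite /dot sum3 => xz; apply/rowP => j.
rewrite comb_rowE !perp_rowE; apply: (mulfI nzi).
have E k y : x 0 i * (k / x 0 i * y) =
  k * y by rewrite mulrA mulrCA divff ?mulr1.
rewrite mulrDr mulNr mulrN !E; move: i j {nzi E}.
(* Only the entry [j = i] requires the orthogonality relation, subtracted in the second branch. *)
by elim/ord3_ind; elim/ord3_ind; rewrite !add3E !crossmxE;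
  (ring || (rewrite -[LHS]subr0 -xz; ring)).
Qed.

Lemma dot_perp_row x i : dot x (perp_row x i) = 0.
Proof.
by rewrite /dot sum3 !perp_rowE; move: i; elim/ord3_ind; rewrite !crossmxE;
  ring.
Qed.

Lemma perp_row_free x i s t : x 0 i != 0 ->
  s *: perp_row x (i + 1) + t *: perp_row x (i + 2%:R) = 0 -> s = 0 /\ t = 0.
Proof.
move=> nzi /rowP e.
have eE j : s * crossmx (x 0) (i + 1) j + t * crossmx (x 0) (i + 2%:R) j = 0.
  by have := e j; rewrite comb_rowE !perp_rowE [RHS]mxE.
suff [s0 t0] : s * x 0 i = 0 /\ t * x 0 i = 0.
  by split; apply/eqP; [move/eqP: s0|move/eqP: t0];
    rewrite mulf_eq0 (negbTE nzi) orbF.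
have := (eE (i + 1), eE (i + 2%:R)); move: i {nzi e eE}.
by elim/ord3_ind; rewrite !add3E !crossmxE !mulr0 ?mulrN ?add0r ?addr0;
  case=> -> /eqP; rewrite oppr_eq0 => /eqP->.
Qed.

Lemma bform_perp_row x S a b :
  bform S (perp_row x a) (perp_row x b) = - sandwich (x 0) S a b.
Proof.
rewrite /bform /perp_row -row_mul /sandwich mxE [X in - X]mxE -sumrN.
apply: eq_bigr => k _; rewrite [row _ _ _ _]mxE -mulrN; congr (_ * _).
by rewrite [LHS]mxE [LHS]mxE -[in RHS](trmxK (crossmx (x 0))) trmx_crossmx
  [in RHS]mxE [in RHS]mxE opprK.
Qed.
End Perp.

Section Surface.
Variable K : closedFieldType.
Hypothesis nz2 : (2%:R : K) != 0.
Variables (N : nat) (rk : 'I_3 * 'I_3 * ('I_3 * 'I_3) -> 'I_N).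
Implicit Types (c u : 'rV[K]_N) (x z : 'rV[K]_3).

Lemma double_eq0 (a : K) : a *+ 2 = 0 -> a = 0.
Proof. by move/eqP; rewrite -mulr_natl mulf_eq0 (negbTE nz2) => /eqP. Qed.

Definition gram_at c x : 'M[K]_3 := map_mx (meval (x 0)) (gram rk c).

Lemma gram_at_sym c x : (gram_at c x)^T = gram_at c x.
Proof. by rewrite /gram_at map_trmx gram_sym. Qed.

Lemma biform_gram c x z : biform rk c x z *+ 2 = bform (gram_at c x) z z.
Proof.
pose T k l := \sum_i \sum_j bicoef rk c i j k l * (x 0 i * x 0 j).
have GE k l : gram_at c x k l = T k l + T l k.
  rewrite !mxE raddf_sum -big_split; apply: eq_bigr => i _ /=.
  rewrite raddf_sum -big_split; apply: eq_bigr => j _ /=.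
  by rewrite mevalZ mevalM !mevalXU mulrDl.
rewrite /bform mxE; under eq_bigr => l _.
  rewrite mxE mulr_suml; under eq_bigr => k _.
    rewrite GE mxE (_ : _ * _ =
      T k l * (z 0 k * z 0 l) + T l k * (z 0 l * z 0 k)); last by ring.
    over.
  rewrite big_split; over.
by rewrite big_split /= mulr2n; congr (_ + _); rewrite exchange_big.
Qed.

Lemma biformP a c u x z :
  biform rk (a *: c + u) x z = a * biform rk c x z + biform rk u x z.
Proof.
rewrite /biform mulr_sumr -big_split; apply: eq_bigr => k _ /=.
rewrite mulr_sumr -big_split; apply: eq_bigr => l _ /=.
rewrite [a * _]mulrA -mulrDl; congr (_ * _).
rewrite mulr_sumr -big_split; apply: eq_bigr => i _ /=.
rewrite mulr_sumr -big_split; apply: eq_bigr => j _ /=.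
by rewrite /bicoef !mxE; ring.
Qed.

Lemma bform_comb (S : 'M[K]_3) (y w : 'rV[K]_3) s t : S^T = S ->
  bform S (s *: y + t *: w) (s *: y + t *: w) =
  bform S y y * s ^+ 2 + bform S y w * s * t *+ 2 + bform S w w * t ^+ 2.
Proof.
move=> sS; rewrite bformDl !bformZl ![bform S _ (_ +
  _)]bformC // !bformDl !bformZl.
by rewrite (bformC w y) //; ring.
Qed.

(** In the basis of [perp_span] the Gram matrix of the form consists of entries of [- sandwich],
    which is zero at x. *)
Lemma biform_negligible u x z : negligible rk u -> x != 0 -> dot x z = 0 ->
  biform rk u x z = 0.
Proof.
move=> u0 /rV0Pn[i nzi] xz.
have W0 : sandwich (x 0) (gram_at u x) = 0.
  have := map_sandwich (meval (x 0)) (fun i : 'I_3 => 'X_i) (gram rk u).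
  rewrite u0 map_mx0 => ->; congr sandwich.
  by apply/funext => j /=; rewrite mevalXU.
have := biform_gram u x z;
  rewrite (perp_span nzi xz) bform_comb ?gram_at_sym //.
rewrite !bform_perp_row W0 !mxE oppr0 !mul0r mul0rn !addr0.
exact: double_eq0.
Qed.

Definition surface c : set 'rV[K]_(3 + 3) :=
  [set v | flag_variety v /\ biform rk c (lsubmx v) (rsubmx v) = 0].

Lemma flag_varietyE (v : 'rV[K]_(3 + 3)) : flag_variety v <->
  [/\ lsubmx v != 0, rsubmx v != 0 & dot (lsubmx v) (rsubmx v) = 0].
Proof.
have -> : dot (lsubmx v) (rsubmx v) = ev (incidence K) v; last by [].
rewrite /ev raddf_sum; apply: eq_bigr => i _ /=.
by rewrite mevalM !mevalXU !mxE.
Qed.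

Lemma surface_negligible c u : negligible rk (c - u) -> surface c = surface u.
Proof.
move=> cu0; apply/seteqP.
suff eq_cu v : flag_variety v ->
    biform rk c (lsubmx v) (rsubmx v) = biform rk u (lsubmx v) (rsubmx v).
  by split=> v [Fv b0]; split=> //; rewrite -?eq_cu // eq_cu.
move=> /flag_varietyE[nzx _ xz]; apply/eqP;
  rewrite -subr_eq0 -(biform_negligible cu0 nzx xz).
by rewrite [c - u]addrC -scaleN1r biformP mulN1r addrC.
Qed.

Lemma surfaceZ k c : k != 0 -> surface (k *: c) = surface c.
Proof.
move=> nzk; have bZ x z : biform rk (k *: c) x z = k * biform rk c x z.
  have b0 : biform rk 0 x z = 0.
    have /eqP := biformP 1 0 0 x z; rewrite scale1r addr0 mul1r -subr_eq0 opprD.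
    by rewrite addNKr oppr_eq0 => /eqP.
  by rewrite -[k *: c]addr0 biformP b0 addr0.
apply/seteqP; split=> v [Fv]; rewrite ?bZ => b0; split=> //;
  last by rewrite bZ b0 mulr0.
by move/eqP: b0; rewrite mulf_eq0 (negbTE nzk) => /eqP.
Qed.

Lemma discriminant_at c x :
  (discriminant rk c c).@[x 0] = bdisc (x 0) (gram_at c x) (gram_at c x).
Proof.
rewrite /discriminant (rmorph_bdisc (meval (x 0))) /gram_at.
by congr bdisc; apply/funext => i /=; rewrite mevalXU.
Qed.

(** In the basis of [perp_span] the fibre is cut out by a binary quadratic form, and by
    [sandwich_minor] twice its discriminant is [x 0 i ^+ 2] times the value of the sextic. *)
Lemma fibre1_surface c x : x != 0 ->
  fibre1 (surface c) x #= `I_2 <-> (discriminant rk c c).@[x 0] != 0.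
Proof.
move=> nzx; have /rV0Pn[i nzi] := nzx.
pose S := gram_at c x; have sS : S^T = S := gram_at_sym c x.
pose y := perp_row x (i + 1); pose w := perp_row x (i + 2%:R).
have := binary_form_lines nz2 (bform S y y) (bform S y w) (bform S w w)
  (fun s t => @perp_row_free _ x i s t nzi).
set F := (X in X #= _) => FP.
have -> : fibre1 (surface c) x = F.
  rewrite /fibre1 /F; congr image; apply/seteqP.
  have bE z : (biform rk c x z = 0) <-> (bform S z z = 0).
    rewrite -biform_gram; split=> [->|/double_eq0//].
    by rewrite mul0rn.
  split=> z /=.
    case=> /flag_varietyE; rewrite !row_mxKl !row_mxKr => -[_ nzz xz] /bE b0.
    split=> //; exists (- (z 0 (i + 2%:R) / x 0 i)), (z 0 (i + 1) / x 0 i).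
    have zE := perp_span nzi xz; split=> //.
    by rewrite -bform_comb // -zE.
  move=> [nzz [s [t [zE q0]]]].
  split; last by rewrite row_mxKl row_mxKr; apply/bE; rewrite zE bform_comb.
  apply/flag_varietyE; rewrite row_mxKl row_mxKr; split=> //.
  rewrite zE /dot.
  under eq_bigr => j _ do rewrite comb_rowE mulrDr [X in X +
    _]mulrCA [X in _ + X]mulrCA.
  by rewrite big_split -!mulr_sumr /= -!/(dot _ _) !dot_perp_row !mulr0 addr0.
rewrite FP discriminant_at -/S.
have := sandwich_minor (x 0) (i + 1) (i + 1) (i + 2%:R) (i + 2%:R) sS.
rewrite !bform_perp_row.
have -> : sandwich (x 0) S (i + 2%:R) (i + 1) =
  sandwich (x 0) S (i + 1) (i + 2%:R).
  by rewrite -{1}(trmx_sandwich (x 0) sS) mxE.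
set W := sandwich _ _ => e.
have {}e : 2%:R * (- W (i + 1) (i + 1) * - W (i + 2%:R) (i + 2%:R)
      - (- W (i + 1) (i + 2%:R)) ^+ 2) = bdisc (x 0) S S * (x 0 i) ^+ 2.
  have -> : x 0 i ^+ 2 = crossmx (x 0) (i + 1) (i + 2%:R) ^+ 2.
    by move: {nzi y w F FP W e} i; elim/ord3_ind; rewrite !add3E !crossmxE;
      ring.
  by rewrite expr2 mulrA -e; ring.
split; last by apply: contra => /eqP W0; move/eqP: e;
  rewrite W0 mulr0 eq_sym mulf_eq0 expf_eq0 (negbTE nzi) orbF.
by apply: contra => /eqP d0; move/eqP: e;
  rewrite d0 mul0r mulf_eq0 (negbTE nz2).
Qed.
End Surface.

(** * The action of GL_3 *)

Section Biforms.
Variable K : closedFieldType.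
Local Notation index := ('I_3 * 'I_3 * ('I_3 * 'I_3))%type.
Variables (N : nat) (rk : index -> 'I_N) (unrk : 'I_N -> index).
Hypothesis rkK : cancel rk unrk.
Local Notation vec := 'rV[K]_3.
Implicit Types h : vec -> vec -> K.

Definition is_biform h := exists c, forall x z, h x z = biform rk c x z.

Lemma is_biform_ext h h' : (forall x z,
  h x z = h' x z) -> is_biform h -> is_biform h'.
Proof. by move=> e [c cE]; exists c => x z; rewrite -e cE. Qed.

Lemma is_biform0 : is_biform (fun _ _ => 0).
Proof.
exists 0 => x z; apply/esym; have /eqP := biformP rk 1 0 0 x z.
by rewrite scale1r addr0 mul1r -subr_eq0 opprD addNKr oppr_eq0 => /eqP.
Qed.

Lemma is_biform_comb a h h' : is_biform h -> is_biform h' ->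
  is_biform (fun x z => a * h x z + h' x z).
Proof. by move=> [c e] [d e']; exists (a *: c + d) => x z;
  rewrite biformP e e'. Qed.

Lemma is_biform_sum (I : eqType) (r : seq I) (a : I -> K) (H :
  I -> vec -> vec -> K) :
  (forall i, i \in r -> is_biform (H i)) ->
  is_biform (fun x z => \sum_(i <- r) a i * H i x z).
Proof.
elim: r => [|i r IH] bH.
  by apply: is_biform_ext is_biform0 => x z; rewrite big_nil.
apply: (@is_biform_ext (fun x z =>
  a i * H i x z + \sum_(j <- r) a j * H j x z)).
  by move=> x z; rewrite big_cons.
apply: is_biform_comb; first by apply: bH; rewrite mem_head.
by apply: IH => j jr; apply: bH; rewrite inE jr orbT.
Qed.

Lemma is_biform_prod (a b p q : 'I_3 -> K) : is_biform (fun x z =>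
  (\sum_i x 0 i * a i) * (\sum_i x 0 i * b i)
    * ((\sum_i z 0 i * p i) * (\sum_i z 0 i * q i))).
Proof.
exists (\row_n (let: ((i, j), (k, l)) :=
  unrk n in a i * b j * (p k * q l))) => x z.
rewrite /biform [(\sum_i z 0 i * p i) * _]big_distrlr /= mulr_sumr.
apply: eq_bigr => k _ /=.
rewrite mulr_sumr; apply: eq_bigr => l _ /=.
have -> : \sum_i \sum_j bicoef rk (\row_n (let: ((i, j), (k, l)) := unrk n in
     a i * b j * (p k * q l))) i j k l * (x 0 i * x 0 j) =
   (\sum_i x 0 i * a i) * (\sum_i x 0 i * b i) * (p k * q l).
  rewrite big_distrlr mulr_suml; apply: eq_bigr => i _ /=.
  rewrite mulr_suml; apply: eq_bigr => j _ /=.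
  by rewrite /bicoef mxE rkK; ring.
by ring.
Qed.

(** After substitution each monomial is a product of two linear forms in x and two in z, so
    [is_biform_prod] applies termwise. *)
Lemma is_biform_subst h (A B : 'M[K]_3) : is_biform h ->
  is_biform (fun x z => h (x *m A) (z *m B)).
Proof.
move=> [c hE].
pose H (t : index) (x z : vec) : K := (x *m A) 0 t.1.1 * (x *m A) 0 t.1.2
   * ((z *m B) 0 t.2.1 * (z *m B) 0 t.2.2).
apply: (@is_biform_ext (fun x z => \sum_(t <- index_enum {: index})
    bicoef rk c t.1.1 t.1.2 t.2.1 t.2.2 * H t x z)).
  move=> x z; rewrite hE /biform.
  transitivity (\sum_(s : 'I_3 * 'I_3) \sum_(t : 'I_3 * 'I_3)
     bicoef rk c s.1 s.2 t.1 t.2 * H (s, t) x z).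
    by rewrite pair_big /=; apply: eq_bigr => -[[i j] [k l]] _.
  rewrite exchange_big [RHS](pair_big_dep xpredT (fun _ => xpredT)).
  apply: eq_bigr => -[k l] _ /=; rewrite mulr_suml.
  rewrite -(pair_big xpredT xpredT (fun i j =>
    bicoef rk c i j k l * H (i, j, (k, l)) x z)) /=.
  apply: eq_bigr => i _; rewrite mulr_suml; apply: eq_bigr => j _.
  by rewrite /H /=; ring.
apply: is_biform_sum => -[[i j] [k l]] _.
apply: is_biform_ext (is_biform_prod (A^~ i) (A^~ j) (B^~ k) (B^~ l)) => x z.
by rewrite /H !mxE.
Qed.

Lemma prod_degree2 (m : 'I_3 -> nat) : (\sum_i m i = 2)%N ->
  exists i j, forall y : 'I_3 -> K, \prod_i y i ^+ m i = y i * y j.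
Proof.
move=> m2; have [i mi] : exists i, (0 < m i)%N.
  apply: contrapT => /forallNP m0; move: m2; rewrite big1 // => i _.
  by apply/eqP; rewrite -leqn0 leqNgt; apply/negP/m0.
have [j mj] : exists j, (0 < m j - (j == i))%N.
  apply: contrapT => /forallNP m0; have : (\sum_j (m j - (j == i)) = 0)%N.
    by rewrite big1 // => j _; apply/eqP; rewrite -leqn0 leqNgt; apply/negP/m0.
  rewrite sumnB; last by move=> j _; case: eqP => // ->.
  by rewrite m2 (bigD1 i) //= eqxx big1 // => j /negbTE->.
have sum0 : (\sum_k (m k - (k == i) - (k == j)) = 0)%N.
  have le1 k : ((k == i) <= m k)%N by case: eqP => // ->.
  have le2 k : ((k == j) <= m k - (k == i))%N by case: (k =P j) => [->|].
  have s1 l : (\sum_(k < 3) (k == l) = 1)%N.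
    by rewrite (bigD1 l) //= eqxx big1 // => k /negbTE->.
  by rewrite sumnB // sumnB // m2 !s1.
exists i, j => y.
have mE k : m k = ((k == i) + (k == j))%N.
  move/eqP: sum0; rewrite sum_nat_eq0 => /forallP/(_ k)/implyP/(_ isT).
  rewrite -subnDA subn_eq0 => le; apply/eqP; rewrite eqn_leq le /=.
  case: (k =P j) => [->|_]; first by rewrite addn1 -subn_gt0.
  by rewrite addn0; case: (k =P i) => // ->.
under eq_bigr => k _ do rewrite mE exprD.
have pE l : \prod_k y k ^+ (k == l) = y l.
  rewrite (bigD1 l) //= eqxx expr1 big1 ?mulr1 // => k /negbTE->.
  by rewrite expr0.
by rewrite big_split /= !pE.
Qed.

Lemma is_biform_ev (q : {mpoly K[3 + 3]}) : bihomog 2 2 q ->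
  is_biform (fun x z => ev q (row_mx x z)).
Proof.
move=> homq; apply: (@is_biform_ext (fun x z => \sum_(m <- msupp q) q@_m *
   ((\prod_i x 0 i ^+ m (lshift 3 i)) * (\prod_i z 0 i ^+ m (rshift 3 i))))).
  move=> x z; rewrite /ev mevalE; apply: eq_bigr => m _; congr (_ * _).
  rewrite big_split_ord; congr (_ * _); apply: eq_bigr => i _.
    by rewrite row_mxEl.
  by rewrite row_mxEr.
apply: is_biform_sum => m /homq[/prod_degree2[i [j ijE]] /prod_degree2[k [l
  klE]]].
pose d (i k : 'I_3) : K := (k == i)%:R.
have dE (y : vec) n : \sum_k y 0 k * d n k = y 0 n.
  rewrite (bigD1 n) //= /d eqxx mulr1 big1 ?addr0 // => t /negbTE->.
  by rewrite mulr0.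
apply: is_biform_ext (is_biform_prod (d i) (d j) (d k) (d l)) => x z.
by rewrite !dE (ijE (x 0)) (klE (z 0)).
Qed.
End Biforms.

(** * Transport of surfaces, fibres and branch curves *)

Section Action.
Variable K : closedFieldType.
Implicit Types (g h : 'M[K]_3) (v : 'rV[K]_(3 + 3)).

Lemma delta_mul g h : g \in unitmx -> h \in unitmx ->
  delta (g *m h) = delta g *m delta h.
Proof.
move=> ug uh; rewrite /delta det_mulmx.
have -> : invmx (g *m h) = invmx h *m invmx g := invrM ug uh.
by rewrite trmx_mul -scalemxAl -scalemxAr scalerA.
Qed.

Lemma delta1 : delta (1%:M : 'M[K]_3) = 1%:M.
Proof. by rewrite /delta det1 invmx1 trmx1 scale1r. Qed.

Lemma act_comp g h v : g \in unitmx -> h \in unitmx ->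
  act h (act g v) = act (g *m h) v.
Proof.
by move=> ug uh; rewrite /act row_mxKl row_mxKr delta_mul // !mulmxA.
Qed.

Lemma act1 v : act 1%:M v = v.
Proof. by rewrite /act delta1 !mulmx1 hsubmxK. Qed.

Lemma actK g : g \in unitmx -> cancel (act g) (act (invmx g)).
Proof. by move=> ug v; rewrite act_comp ?unitmx_inv // mulmxV // act1. Qed.

Lemma actKV g : g \in unitmx -> cancel (act (invmx g)) (act g).
Proof. by move=> ug v; rewrite act_comp ?unitmx_inv // mulVmx // act1. Qed.

Lemma delta_unit g : g \in unitmx -> delta g \in unitmx.
Proof.
move=> ug; apply: (mulmx1_unit (B := delta (invmx g)) _).1.
by rewrite -delta_mul ?unitmx_inv // mulmxV // delta1.
Qed.

Lemma GL3_orbit_act g (X : set 'rV[K]_(3 + 3)) : g \in unitmx ->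
  GL3_orbit (act g @` X) = GL3_orbit X.
Proof.
move=> ug; apply/seteqP; split=> _ [h uh ->].
  exists (g *m h); first by rewrite unitmx_mul ug.
  by rewrite image_comp; apply: eq_imagel => v _ /=; rewrite act_comp.
exists (invmx g *m h); first by rewrite unitmx_mul unitmx_inv ug.
rewrite image_comp; apply: eq_imagel => v _ /=.
by rewrite act_comp // ?unitmx_mul ?unitmx_inv ?ug // mulmxA mulmxV // mul1mx.
Qed.

Lemma mulmx_unit_neq0 n (x : 'rV[K]_n) (A : 'M[K]_n) : A \in unitmx ->
  (x *m A != 0) = (x != 0).
Proof.
move=> uA; congr negb; apply/eqP/eqP => [e|->]; last by rewrite mul0mx.
by rewrite -(mulmxK uA x) e mul0mx.
Qed.

Lemma dot_act g (x z : 'rV[K]_3) : g \in unitmx ->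
  dot (x *m g) (z *m delta g) = \det g * dot x z.
Proof.
have dotE (y w : 'rV[K]_3) : dot y w = (y *m w^T) 0 0.
  by rewrite mxE; apply: eq_bigr => i _; rewrite mxE.
move=> ug; rewrite !dotE /delta -scalemxAr linearZ /= trmx_mul trmxK.
by rewrite -scalemxAr mxE !mulmxA mulmxK.
Qed.

Lemma flag_variety_act g v : g \in unitmx ->
  flag_variety (act g v) <-> flag_variety v.
Proof.
move=> ug; rewrite !flag_varietyE row_mxKl row_mxKr !mulmx_unit_neq0
  ?delta_unit //.
rewrite dot_act //; have nzd : \det g != 0 by rewrite -unitfE -unitmxE.
split=> -[? ?]; last by move->; rewrite mulr0.
by move/eqP; rewrite mulf_eq0 (negbTE nzd) => /eqP.
Qed.

Lemma act_cut N (rk : 'I_3 * 'I_3 * ('I_3 * 'I_3) -> 'I_N) unrk g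
    (q : {mpoly K[3 + 3]}) : cancel rk unrk -> g \in unitmx -> bihomog 2 2 q ->
  exists c, act g @` cut q = surface rk c.
Proof.
move=> rkK ug homq; have ug' : invmx g \in unitmx by rewrite unitmx_inv.
have [c cE] := is_biform_subst rkK (invmx g) (delta (invmx g)) (is_biform_ev
  rkK homq).
exists c; apply/seteqP; split=> [_ [v [Fv qv] <-]|v [Fv bv]].
  split; first exact/flag_variety_act.
  by rewrite -cE -/(act (invmx g) (act g v)) actK.
exists (act (invmx g) v); last exact: actKV.
by split; [exact/flag_variety_act | rewrite /act cE].
Qed.

(** The invertible map [delta g] induces an injection on lines that carries one fibre onto the
    other. *)
Lemma fibre1_act g (X : set 'rV[K]_(3 + 3)) x : g \in unitmx ->
  fibre1 (act g @` X) (x *m g) #= fibre1 X x.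
Proof.
move=> ug; pose f := linfun (mulmxr (delta g) : 'rV[K]_3 -> 'rV[K]_3).
have fE z : f z = z *m delta g by rewrite lfunE.
have kerf : lker f == 0%VS.
  apply/lker0P => z w; rewrite !fE => e.
  by rewrite -(mulmxK (delta_unit ug) z) e mulmxK ?delta_unit.
have -> : fibre1 (act g @` X) (x *m g) = (fun V => (f @: V)%VS) @` fibre1 X x.
  apply/seteqP; split=> [_ [z [v Xv vE] <-]|_ [_ [z Xz <-] <-]].
    have [ex ez] := eq_row_mx vE.
    have def_x : lsubmx v = x by rewrite -(mulmxK ug (lsubmx v)) ex mulmxK.
    exists <[rsubmx v]>%VS; last by rewrite limg_line fE ez.
    by exists (rsubmx v) => //; rewrite /= -def_x hsubmxK.
  exists (z *m delta g); last by rewrite limg_line fE.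
  by exists (row_mx x z) => //; rewrite /act row_mxKl row_mxKr.
apply: inj_card_eq => V W _ _ /(congr1 (fun U => (f^-1 @: U)%VS)).
by rewrite -!limg_comp lker0_compVf // !lim1g.
Qed.

Lemma branch_act g (X : set 'rV[K]_(3 + 3)) : g \in unitmx ->
  branch (fibre1 (act g @` X)) = [set x *m g | x in branch (fibre1 X)].
Proof.
move=> ug; have cardE x : fibre1 (act g @` X) (x *m g) #= `I_2 <-> fibre1 X x
  #= `I_2.
  have e := fibre1_act X x ug; split; apply: card_eq_trans => //.
  by rewrite card_eq_sym.
apply/seteqP; split=> [y [nzy Fy]|_ [x [nzx Fx] <-]].
  exists (y *m invmx g); last by rewrite mulmxKV.
  by split; [rewrite mulmx_unit_neq0 ?unitmx_inv | rewrite -cardE mulmxKV].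
by split; [rewrite mulmx_unit_neq0 | rewrite cardE].
Qed.
End Action.

(** * Finiteness *)

Section Finiteness.
Variable K : closedFieldType.
Hypothesis K_uncountable : ~ countable [set: K].
Hypothesis K_char0 : forall m, (m.+1%:R : K) != 0.
Local Notation index := ('I_3 * 'I_3 * ('I_3 * 'I_3))%type.
Variables (f : {mpoly K[3]}).
Hypotheses (nz_f : f != 0) (homf : f \is 6.-homog).
Hypothesis smooth_f : forall v : 'I_3 -> K, (exists i, v i != 0) ->
  f.@[v] = 0 -> exists i, (mderiv i f).@[v] != 0.

Let nz2 : (2%:R : K) != 0 := K_char0 1.

(** By the Euler identity, 6 being invertible, a common zero of the partials lies on f = 0, hence is
    the origin by smoothness; the Nullstellensatz concludes. *)
Let irrelevant i : exists N, ideal_gen (fun l => mderiv l f) ('X_i ^+ N).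
Proof.
apply: nullstellensatz => // v dv0; rewrite mevalXU.
apply/eqP/negPn/negP => nzvi.
have [|l /eqP[//]] := smooth_f (ex_intro _ i nzvi).
have := congr1 (meval v) (euler_homog homf).
rewrite raddf_sum big1 /= => [|l _]; last by rewrite mevalM dv0 mulr0.
move/esym/eqP; rewrite raddfMn /= -mulr_natl mulf_eq0 (negbTE (K_char0 5)).
by move/eqP.
Qed.

Variables (N M : nat) (rk : index -> 'I_N) (unrk : 'I_N -> index).
Variable mon : 'I_M -> 'X_{1..3}.
Hypothesis rkK : cancel rk unrk.
Hypothesis monP : forall m, mdeg m = 6%N -> exists j, mon j = m.

(** The quadratic system is [polar]; the injectivity of its differential modulo negligible vectors
    is [apolar_eq0]. *)
Lemma discriminant_fibre_finite : exists B, forall cs : 'I_B -> 'rV[K]_N,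
  (forall j, discriminant rk (cs j) (cs j) = f) ->
  exists i j, i != j /\ negligible rk (cs i - cs j).
Proof.
have sym_polar (p q : 'rV[K]_N) : p *m polar rk mon q = q *m polar rk mon p.
  by rewrite !mul_polar discriminantC.
have polar0 (u : 'rV[K]_N) : negligible rk u -> forall q,
  u *m polar rk mon q = 0.
  move=> u0 q; rewrite mul_polar negligible_discriminant //.
  by apply/rowP => j; rewrite !mxE mcoeff0.
have ker_polar (p u : 'rV[K]_N) : p *m polar rk mon p = \row_j f@_(mon j) ->
    u *m polar rk mon p = 0 -> negligible rk u.
  move=> /(mul_polarP rk monP _ _ homf) pf up.
  have up0 : discriminant rk u p = 0.
    apply/(mul_polarP rk monP); first exact: rpred0.
    by rewrite up; apply/rowP => j; rewrite !mxE mcoeff0.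
  have dpu : bdisc (fun i => 'X_i) (gram rk p) (gram rk u) = 0.
    by rewrite bdiscC.
  exact: (apolar_eq0 nz2 (gram_sym rk p) (gram_sym rk u) (gram_homog rk p)
    (gram_homog rk u) pf dpu homf (kill_var_neq0 homf irrelevant) irrelevant
    (erefl _) (erefl _)).
have [B BP] := quadratic_fibre_finite nz2 sym_polar polar0 ker_polar.
by exists B => cs csf; apply: BP => j; apply/(mul_polarP rk monP).
Qed.

(** Moving X by [g] makes f = 0 the zero set of the discriminant, which is then a multiple [k *: f];
    rescaling the equation by a square root of [k^-1] makes it equal to [f]. *)
Lemma normal_form (X : set 'rV[K]_(3 + 3)) (C : set 'rV[K]_3) :
   C = [set x | x != 0 /\ ev f x = 0] ->
  generic_K3 X -> proj_equiv (branch (fibre1 X)) C ->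
  exists2 c, discriminant rk c c = f & GL3_orbit X = GL3_orbit (surface rk c).
Proof.
move=> CE [q [homq -> _ _ _]] [g ug gC].
have [c cE] := act_cut rkK ug homq.
have fE (x : 'rV[K]_3) : x != 0 -> (discriminant rk c c).@[x 0] =
  0 <-> f.@[x 0] = 0.
  move=> nzx; have := branch_act (cut q) ug; rewrite gC cE CE => /seteqP[le ge].
  split=> e.
    have [|_ //] := le x; split=> // /(fibre1_surface nz2 rk c nzx).
    by rewrite e eqxx.
  have [//|_ nF] := ge x; apply/eqP/negPn/negP => nzD; apply: nF.
  exact/(fibre1_surface nz2 rk c nzx).
have rowE (v : 'I_3 -> K) : (\row_i v i) 0 = v by apply/funext => i;
  rewrite mxE.
have [k kE] : exists k, discriminant rk c c = k *: f.
  apply: (proportional_of_smooth K_uncountable K_char0 nz_f homf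
    (discriminant_homog rk c c) irrelevant).
  move=> v fv; have [v0|nzv] := eqVneq (\row_i v i) 0; last first.
    by rewrite -(rowE v); apply/fE => //; rewrite rowE.
  rewrite -(rowE v) v0 discriminant_at /bdisc big1 // => i _.
  by rewrite big1 // => j _; rewrite mxE !mul0r.
(* Otherwise [f] would vanish at every nonzero vector, and at the origin by the Euler identity. *)
have nzk : k != 0.
  apply/eqP => k0; case/eqP: nz_f; apply: mpoly_eq0 => // v.
  have [v0|nzv] := eqVneq (\row_i v i) 0; last first.
    by rewrite -(rowE v); apply/fE => //; rewrite kE k0 scale0r meval0.
  have := congr1 (meval v) (euler_homog homf).
  rewrite raddf_sum big1 /= => [|l _]; last first.
    have vl : v l = 0 by rewrite -(rowE v) v0 mxE.
    by rewrite mevalM mevalXU vl mul0r.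
  move/esym/eqP; rewrite raddfMn /= -mulr_natl mulf_eq0 (negbTE (K_char0 5)).
  by move/eqP.
have [r rE] : exists r, r ^+ 2 = k^-1.
  have [r] := solve_monicpoly (fun i =>
    if i == 0%N then k^-1 else 0) (isT : (0 < 2)%N).
  by rewrite !big_ord_recl big_ord0 /= => rE; exists r; rewrite rE; ring.
have nzr : r != 0 by rewrite -sqrf_eq0 rE invr_eq0.
have discZ a u v : discriminant rk u (a *: v) = a *: discriminant rk u v.
  rewrite -[a *: v]addr0 discriminantP.
  suff -> : discriminant rk u 0 = 0 by rewrite addr0.
  have /eqP := discriminantP rk u 1 0 0; rewrite !scale1r addr0 -subr_eq0 opprD.
  by rewrite addNKr oppr_eq0 => /eqP.
exists (r *: c).
  rewrite discZ discriminantC discZ kE !scalerA -expr2 rE mulVf //.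
  exact: scale1r.
by rewrite surfaceZ // -cE GL3_orbit_act.
Qed.

(** Among [B] distinct orbits in normal form, two would have coefficient vectors with negligible
    difference, hence the same surface. *)
Lemma family_orbits_finite C1 C2 : C1 = [set x | x != 0 /\ ev f x = 0] ->
  finite_set [set GL3_orbit X | X in @K3_family K C1 C2].
Proof.
move=> C1E; apply: contrapT => inf.
have [B BP] := discriminant_fibre_finite.
have [O sO leB] := infinite_set_fset B inf.
pose o := tnth (in_tuple (enum_fset O)).
have lt_j (j : 'I_B) : (j < #|` O|)%N := leq_trans (ltn_ord j) leB.
pose orb j := o (Ordinal (lt_j j)).
have orbP j : exists2 c, discriminant rk c c = f & orb j =
  GL3_orbit (surface rk c).
  have [|X [gX _ p1 _] <-] := sO (orb j); first exact: mem_tnth.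
  exact: normal_form C1E gX p1.
have /choice[cs csP] : forall j, exists c,
    discriminant rk c c = f /\ orb j = GL3_orbit (surface rk c).
  by move=> j; have [c] := orbP j; exists c.
have [|i [j [/eqP nij neg]]] := BP cs; first by move=> j; case: (csP j).
apply: nij; have : orb i = orb j.
  have [_ ->] := csP i; have [_ ->] := csP j.
  by rewrite (surface_negligible nz2 neg).
rewrite /orb /o !(tnth_nth (orb i)) /= => /eqP.
by rewrite nth_uniq ?lt_j ?fset_uniq // => /eqP/val_inj.
Qed.
End Finiteness.

Lemma complex_uncountable (R : realType) : ~ countable [set: R[i]].
Proof.
move=> /countable_injP[e /in2TT einj]; apply: (@realType_uncountable R).
apply/countable_injP; exists (fun x : R => e (x%:C)%C) => x y _ _ /einj.
by case.
Qed.

Theorem theorem14 (R : realType) (C1 C2 : set 'rV[R[i]]_3)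
    (hC1 : smooth_sextic C1) (hC2 : smooth_sextic C2) :
  finite_set [set GL3_orbit X | X in K3_family C1 C2].
Proof.
have [f [homf nz_f C1E smooth_f]] := hC1.
(* The abstract codings are instantiated by enumerations of the index quadruples and of the
   monomials of degree less than 7. *)
apply: (@family_orbits_finite _ (@complex_uncountable R) _ f nz_f homf _ _ _
  (@enum_rank _) (@enum_val _ _) (fun j =>
    bmnm (@enum_val _ {: 'X_{1..3 < 7}} j))) => //.
- by move=> m; rewrite pnatr_eq0.
- move=> v [i nzvi] fv; have rowE : (\row_i v i) 0 = v by apply/funext => k;
    rewrite mxE.
  have [|k] := smooth_f (\row_i v i); last by rewrite /ev rowE; exists k.
  rewrite C1E /=; split; last by rewrite /ev rowE.
  by apply/rV0Pn; exists i; rewrite mxE.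
- exact: enum_rankK.
- move=> m m6; have ltm : (mdeg m < 7)%N by rewrite m6.
  by exists (enum_rank (BMultinom ltm)); rewrite enum_rankK.
Qed.
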